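(* Let $G$ be a finite undirected graph and $K\subseteq V(G)$ such that $G[K]$ is a complete graph, and let $\mathcal{G}$ be a set of generating faces of $\mathrm{Ind}(G\setminus K)$ such that for each $k\in K$ and each $\sigma\in\mathcal{G}$, some vertex of $\sigma$ is adjacent to $k$. Then \[\mathrm{Ind}(G)\simeq\mathrm{Ind}(G\setminus K)\vee\bigvee_{k\in K}\mathrm{susp}\,\mathrm{Ind}(G\setminus(K\cup N(k))).\] Moreover, let $K'=\{k\in K\mid G\setminus(K\cup N(k))\neq\emptyset\}$ and suppose that $\mathcal{G}_k$ is a set of generating faces of $\mathrm{Ind}(G\setminus(K\cup N(k)))$ for each $k\in K'$. Then the union of \[\mathcal{G},\quad\bigcup_{k\in K\setminus K'}\{\{k\}\},\quad\text{and}\quad\bigcup_{k\in K'}\{\{k\}\cup\sigma\mid\sigma\in\mathcal{G}_k\}\] is a set of generating faces of $\mathrm{Ind}(G)$.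
   Context: $N(v)$ is the set of vertices adjacent to $v$; $G[K]$ is the induced subgraph on $K$; $G\setminus W$ is the induced subgraph on $V(G)\setminus W$. $\mathrm{Ind}(H)$ is the simplicial complex with vertex set $V(H)$ whose simplices are the independent sets of $H$; for the empty graph it is the empty complex. Conventions: $\mathrm{susp}(\emptyset)=S^0$, a wedge over an empty index set is a point. A set $\mathcal{G}$ of maximal faces of a simplicial complex $\Delta$ is a set of generating faces if the complex $\Delta\setminus\mathcal{G}$ obtained by removing the faces in $\mathcal{G}$ is contractible (then $\Delta\simeq\bigvee_{\sigma\in\mathcal{G}}S^{\dim\sigma}$). *)

(* Defs.v *)
From HB Require Import structures.
From mathcomp Require Import all_boot all_order all_algebra.
From mathcomp Require Import all_classical all_reals all_analysis.
From mathcomp Require Import wedge_sigT subtype_topology function_spaces.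
Set Implicit Arguments. Unset Strict Implicit. Unset Printing Implicit Defensive.
Import Order.TTheory GRing.Theory Num.Theory.

Import numFieldNormedType.Exports.
Local Open Scope classical_set_scope.
Local Open Scope ring_scope.

Definition simple_graph (T : finType) (e : rel T) :=
  symmetric e /\ irreflexive e.

Definition nbhd (T : finType) (e : rel T) (v : T) : {set T} := [set u | e v u].

Definition independent (T : finType) (e : rel T) (s : {set T}) :=
  [forall x in s, forall y in s, ~~ e x y].

(* Ind(G[W]) : faces are independent subsets of W (including the empty face).
   G \ W' is G[~: W'].  For W = set0 this is the empty complex {emptyset}. *)
Definition Ind (T : finType) (e : rel T) (W : {set T}) : {set {set T}} :=
  [set s : {set T} | (s \subset W) && independent e s].

Definition maximal_face (V : finType) (D : {set {set V}}) (s : {set V}) :=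
  (s \in D) /\ forall t, t \in D -> s \subset t -> t = s.

(* unreduced suspension as a simplicial complex: join with S^0 = {a},{b};
   vertices V + bool (the two apexes are inr true / inr false).
   susp of the empty complex {emptyset} is S^0. *)
Definition susp (V : finType) (D : {set {set V}}) : {set {set (V + bool)}} :=
  [set s : {set V + bool} | (inl @^-1: s \in D) && (#|inr @^-1: s| <= 1)%N].

Definition realization_set (R : realType) (V : finType) (D : {set {set V}})
  : set {ptws V -> R} :=
  [set x : {ptws V -> R} | (forall v, 0 <= x v) /\ (\sum_v x v = 1) /\
    [set v | x v != 0]%SET \in D].

Definition realization (R : realType) (V : finType) (D : {set {set V}})
  : topologicalType := set_type (@realization_set R V D).

Definition unit_interval (R : realType) : topologicalType :=
  set_type ([set t : R | 0 <= t <= 1] : set (R : topologicalType)).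

Definition homotopic (R : realType) (X Y : topologicalType) (f g : X -> Y) :=
  exists H : unit_interval R * X -> Y,
    continuous H /\
    (forall (t : unit_interval R) x, set_val t = 0 -> H (t, x) = f x) /\
    (forall (t : unit_interval R) x, set_val t = 1 -> H (t, x) = g x).

Definition homotopy_equivalent (R : realType) (X Y : topologicalType) :=
  exists (f : X -> Y) (g : Y -> X),
    continuous f /\ continuous g /\
    homotopic R (g \o f) idfun /\ homotopic R (f \o g) idfun.

Definition contractible (R : realType) (X : topologicalType) :=
  exists x0 : X, homotopic R (fun _ : X => x0) idfun.

Definition generating_faces (R : realType) (V : finType)
  (D : {set {set V}}) (Gs : {set {set V}}) :=
  (forall s, s \in Gs -> maximal_face D s) /\
  contractible R (realization R (D :\: Gs)).

Definition summand (R : realType) (T : finType) (e : rel T) (K : {set T})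
  (i : option {k : T | k \in K}) : topologicalType :=
  match i with
  | None => realization R (Ind e (~: K))
  | Some k => realization R (susp (Ind e (~: (K :|: nbhd e (val k)))))
  end.

Definition Kprime (T : finType) (e : rel T) (K : {set T}) : {set T} :=
  [set k in K | ~: (K :|: nbhd e k) != finset.set0]%SET.

(* Main.v *)
Require Import Defs.
From HB Require Import structures.
From mathcomp Require Import all_boot all_order all_algebra.
From mathcomp Require Import all_classical all_reals all_analysis.
From mathcomp Require Import wedge_sigT subtype_topology function_spaces.
From mathcomp Require Import ring lra.
Import Order.TTheory GRing.Theory Num.Theory.
Import numFieldNormedType.Exports.

(** A nullhomotopy [h] of the contractible complex A = Ind(G \ K) \ Gs moves every
   link L_k = Ind(G \ (K u N(k))), which lies in A, to one point q0.  Ind(G) is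
   Y = Ind(G \ K) with a cone k * L_k attached for each k in K, and distinct cones
   meet only in Y.  Mapping the lower half of each cone to Y along [h] and its upper
   half to susp L_k gives f : Ind(G) -> Y v V_k susp L_k; running [h] backwards on
   the southern half of each suspension gives g in the other direction.  Both
   composites only insert a detour along [h] and back, which is shortened to nothing.

   For the second claim the same equivalence, applied to Ind(G) minus the given
   faces, yields a wedge of the contractible complex A with suspensions of
   contractible complexes; these contract relative to their south poles.

   All maps into a realization are written as nonnegative vectors with support in
   the complex, and then normalised to mass 1; so continuity only has to be checked
   coordinatewise, and membership reduces to a condition on supports. *)

Set Implicit Arguments. Unset Strict Implicit. Unset Printing Implicit Defensive.
Local Open Scope classical_set_scope.
Local Open Scope ring_scope.

(** * Continuity of real-valued formulas *)

Section RealFunctions.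
Variables (R : realType) (Z : topologicalType).
Implicit Types f g : Z -> R.

(** A face of [Gs] contains a neighbour of k, hence is no face of L_k; this is how the adjacency
    hypothesis puts L_k inside A. The nullhomotopy exists only on A, while Ind(G \ K) may be larger.
    Every formula is therefore arranged so that the flow time is at least 1, where the flow is the
    identity, whenever the base part may leave A.

    Two constraints fix the breakpoints. A point of the wedge has at most one coordinate off its
    base point, so the base coordinate must reach q0 before a suspension coordinate leaves the south
    pole; hence the heights 1/2 and 3/4 in the maps and the time 1/4 on the suspensions. In Ind(G)
    the apex k may carry weight only if the base part lies in L_k, so the flow must be back at the
    identity before apex weight appears; hence the time 1/2 in the round trip on Ind(G).

    The cone statement has K, Y and the L_k as parameters because it is used twice: with Y = Ind(G \
    K) and the full links, then with K', Y = A and the links without G_k. For k in K \ K' the only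
    face containing k is {k}, which is removed, so such apexes disappear in the second use. *)

Lemma continuous_add f g :
  continuous f -> continuous g -> continuous (fun z => f z + g z).
Proof. by move=> cf cg z; apply: cvgD; [exact: cf|exact: cg]. Qed.

Lemma continuous_sub f g :
  continuous f -> continuous g -> continuous (fun z => f z - g z).
Proof. by move=> cf cg z; apply: cvgB; [exact: cf|exact: cg]. Qed.

Lemma continuous_opp f : continuous f -> continuous (fun z => - f z).
Proof. by move=> cf z; apply: cvgN; exact: cf. Qed.

Lemma continuous_mul f g :
  continuous f -> continuous g -> continuous (fun z => f z * g z).
Proof. by move=> cf cg z; apply: cvgM; [exact: cf|exact: cg]. Qed.

Lemma continuous_inv f :
  (forall z, f z != 0) -> continuous f -> continuous (fun z => (f z)^-1).
Proof. by move=> f0 cf z; apply: cvgV; [exact: f0|exact: cf]. Qed.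

Lemma continuous_maxr f g :
  continuous f -> continuous g -> continuous (fun z => Num.max (f z) (g z)).
Proof. by move=> cf cg z; apply: continuous_max; [exact: cf|exact: cg]. Qed.

Lemma continuous_minr f g :
  continuous f -> continuous g -> continuous (fun z => Num.min (f z) (g z)).
Proof. by move=> cf cg z; apply: continuous_min; [exact: cf|exact: cg]. Qed.

Lemma continuous_const (c : R) : continuous (fun _ : Z => c).
Proof. by move=> z; exact: cvg_cst. Qed.

Lemma continuous_affine (c e : R) f : continuous f -> continuous (fun z => c * f z - e).
Proof.
move=> cf; apply: continuous_sub; last exact: continuous_const.
by apply: continuous_mul => //; exact: continuous_const.
Qed.

Lemma continuous_coaffine (c e : R) f : continuous f -> continuous (fun z => e - c * f z).
Proof.
move=> cf; apply: continuous_sub; first exact: continuous_const.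
by apply: continuous_mul => //; exact: continuous_const.
Qed.

Lemma cvg_bigsum (I : Type) (s : seq I) (P : pred I) (F : I -> Z -> R) z :
  (forall i, P i -> F i @ z --> F i z) ->
  (fun z' => \sum_(i <- s | P i) F i z') @ z --> \sum_(i <- s | P i) F i z.
Proof.
move=> cF; elim: s => [|i s IH].
  by under eq_fun do rewrite big_nil; rewrite big_nil; exact: cvg_cst.
under eq_fun do rewrite big_cons; rewrite big_cons.
by case Pi: (P i) => //; apply: cvgD => //; exact: cF.
Qed.

Lemma continuous_bigsum (I : Type) (s : seq I) (P : pred I) (F : I -> Z -> R) :
  (forall i, P i -> continuous (F i)) ->
  continuous (fun z => \sum_(i <- s | P i) F i z).
Proof. by move=> cF z; apply: cvg_bigsum => i Pi; exact: cF. Qed.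

End RealFunctions.

Lemma cvg_if_near (Z Y : topologicalType) (P : pred Z) (F G : Z -> Y)
    (z : Z) (l : Y) :
  (forall U, nbhs l U -> \forall z' \near z, P z' -> U (F z')) ->
  (forall U, nbhs l U -> \forall z' \near z, ~~ P z' -> U (G z')) ->
  (fun z' => if P z' then F z' else G z') @ z --> l.
Proof.
move=> cF cG U nU.
apply: (@filterS2 _ (nbhs z) _ _ _ _ _ (cF U nU) (cG U nU)) => z' /= FU GU.
by case: ifP FU GU => [_ + _|_ _]; exact.
Qed.

(** * Geometric realizations and normalisation of vectors *)

Section Realizations.
Variables (R : realType) (V : finType).
Implicit Types (D : {set {set V}}) (x y : V -> R).

Definition coord D (q : realization R D) : V -> R := set_val q.

Definition supp x : {set V} := [set v | x v != 0]%SET.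

Lemma mem_supp x v : (v \in supp x) = (x v != 0).
Proof. by rewrite inE. Qed.

Definition realizable D x :=
  [/\ forall v, 0 <= x v, 0 < \sum_v x v & supp x \in D].

Lemma coordP D (q : realization R D) :
  [/\ forall v, 0 <= coord q v, \sum_v coord q v = 1 & supp (coord q) \in D].
Proof. by have [q0 [q1 q2]] := set_valP q; split. Qed.

Lemma coord_inj D (p q : realization R D) : coord p =1 coord q -> p = q.
Proof. by move=> pq; apply: val_inj; apply/funext. Qed.

Lemma coord_realizable D (q : realization R D) : realizable D (coord q).
Proof. by have [? q1 ?] := coordP q; split; rewrite ?q1 ?ltr01. Qed.

Lemma continuous_coord D v : continuous (fun q : realization R D => coord q v).
Proof.
move=> q.
have c1 : (fun q : realization R D => set_val q : {ptws V -> R}) @ q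
    --> (set_val q : {ptws V -> R}) by exact: initial_continuous.
apply: (@continuous_comp _ _ _ (fun q : realization R D => set_val q : {ptws V -> R})
  (fun y => y v)) => //.
exact: (@proj_continuous V (fun=> R) v).
Qed.

Lemma continuous_comp_coord (Z : topologicalType) D (f : Z -> realization R D) u :
  continuous f -> continuous (fun z => coord (f z) u).
Proof.
move=> cf z; apply: (@continuous_comp _ _ _ f (fun q => coord q u)); first exact: cf.
exact: continuous_coord.
Qed.

(** The realization carries the initial topology for its inclusion into a product, which is itself
    initial for the projections. *)
Lemma realization_cvg (Z : topologicalType) D (F : Z -> realization R D) z :
  (forall v, (fun z' => coord (F z') v) @ z --> coord (F z) v) ->
  F @ z --> F z.
Proof.
move=> cF.
have c1 : (fun z' => set_val (F z') : {ptws V -> R}) @ z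
    --> (set_val (F z) : {ptws V -> R}).
  apply/cvg_sup => v U [B [[W oW <-] /= Ov OU]].
  have := cF v W (open_nbhs_nbhs (conj oW Ov)).
  by apply: (@filterS _ (nbhs z)) => z' Oz'; exact: OU.
move=> U [B [[W oW <-] /= Ov OU]].
have := c1 W (open_nbhs_nbhs (conj oW Ov)).
by apply: (@filterS _ (nbhs z)) => z' Oz'; exact: OU.
Qed.

Lemma realization_closed1 D (p : realization R D) : closed [set p].
Proof.
have -> : [set p] = \bigcap_v [set q | coord q v = coord p v].
  rewrite eqEsubset; split => [q -> v //|q /= pq].
  by apply: coord_inj => v; exact: pq.
apply: closed_bigI => v _.
apply: (@preimage_closed _ _ (fun q : realization R D => coord q v) [set coord p v]).
  by move=> q _; exact: continuous_coord.
exact: closed_eq.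
Qed.

Lemma normalize_set D x : realizable D x ->
  @realization_set R V D (fun v => x v / \sum_u x u : R).
Proof.
move=> [x0 sx xD]; split => [v|]; first by rewrite divr_ge0 // ltW.
split; first by rewrite -mulr_suml divff // gt_eqF.
suff -> : [set v | x v / (\sum_u x u) != 0]%SET = supp x by [].
apply/setP => v; rewrite !inE mulf_eq0 invr_eq0 (gt_eqF sx) orbF //.
Qed.

Definition point_of D x (xD : realizable D x) : realization R D :=
  exist (fun q => q \in @realization_set R V D) _ (mem_set (normalize_set xD)).

(** Made total so that formulas compose without carrying proofs; [p] is only the default off the
    realizable vectors. *)
Definition normalize D (p : realization R D) x : realization R D :=
  if pselect (realizable D x) is left xD then point_of xD else p.

Lemma coord_point_of D x (xD : realizable D x) v :
  coord (point_of xD) v = x v / \sum_u x u.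
Proof. by []. Qed.

Lemma coord_normalize D p x v : realizable D x ->
  coord (@normalize D p x) v = x v / \sum_u x u.
Proof. by rewrite /normalize; case: pselect. Qed.

Lemma normalize_coord D p (q : realization R D) : normalize p (coord q) = q.
Proof.
apply: coord_inj => v; rewrite coord_normalize; last exact: coord_realizable.
by have [_ -> _] := coordP q; rewrite divr1.
Qed.

(** Points are rays of vectors. The identities between composites below are proved by exhibiting the
    scale factor [c]. *)
Lemma normalize_scale D p x y c : realizable D x -> realizable D y ->
  (forall v, y v = c * x v) -> @normalize D p x = normalize p y.
Proof.
move=> xD yD yx; apply: coord_inj => v; rewrite !coord_normalize //.
have c0 : c != 0.
  apply/eqP => c0; have [_ + _] := yD.
  by rewrite big1 ?ltxx// => u _; rewrite yx c0 mul0r.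
rewrite yx; under [in RHS]eq_bigr do rewrite yx.
rewrite -mulr_sumr invfM mulrACA divff // mul1r //.
Qed.

Lemma eq_normalize D p x y : x =1 y -> @normalize D p x = normalize p y.
Proof. by move=> /funext ->. Qed.

Lemma normalize_normalize D D' (p : realization R D) (p' : realization R D') x :
  realizable D' x -> realizable D x ->
  normalize p (coord (normalize p' x)) = normalize p x.
Proof.
move=> xD' xD; have [x0 sx _] := xD.
have E v : coord (normalize p' x) v = (\sum_u x u)^-1 * x v.
  by rewrite coord_normalize // mulrC.
symmetry; apply: (normalize_scale _ xD _ E).
split=> [v||].
- by rewrite E mulr_ge0 // invr_ge0 ltW.
- under eq_bigr do rewrite E.
  by rewrite -mulr_sumr mulVf ?gt_eqF.
- rewrite (_ : supp _ = supp x); first by have [] := xD.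
  by apply/setP => v; rewrite !mem_supp E mulf_eq0 invr_eq0 (gt_eqF sx).
Qed.

Lemma normalize_cvg (Z : topologicalType) D p (F : Z -> V -> R) z :
  (forall z', realizable D (F z')) ->
  (forall v, F ^~ v @ z --> F z v) ->
  (fun z' => normalize p (F z') : realization R D) @ z --> normalize p (F z).
Proof.
move=> FD cF; apply: realization_cvg => v.
under eq_fun do rewrite coord_normalize //.
rewrite coord_normalize //; apply: cvgM; first exact: cF.
apply: cvgV; first by have [_ /gt_eqF -> _] := FD z.
by apply: cvg_bigsum => u _; exact: cF.
Qed.

Lemma normalize_continuous (Z : topologicalType) D p (F : Z -> V -> R) :
  (forall z, realizable D (F z)) -> (forall v, continuous (F ^~ v)) ->
  continuous (fun z => normalize p (F z) : realization R D).
Proof. by move=> FD cF z; apply: normalize_cvg => // v; exact: cF. Qed.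

End Realizations.

Lemma cvg_pair_at (Z X Y : topologicalType) (f : Z -> X) (g : Z -> Y) z :
  f @ z --> f z -> g @ z --> g z -> (fun z => (f z, g z)) @ z --> (f z, g z).
Proof. by move=> cf cg; exact: cvg_pair. Qed.

(** * Homotopies and the unit interval *)

Section Homotopies.
Variable R : realType.

Lemma clamp_proof (t : R) : Num.max 0 (Num.min t 1) \in [set t : R | 0 <= t <= 1].
Proof.
apply/mem_set => /=; rewrite le_max lexx /= ge_max ler01 /= ge_min lexx orbT //.
Qed.

(** Lets times be given by real formulas that overshoot the interval; overshooting means resting at
    an end of the homotopy. *)
Definition clamp (t : R) : unit_interval R :=
  exist (fun t => t \in [set t : R | 0 <= t <= 1]) _ (clamp_proof t).

Definition time (t : unit_interval R) : R := set_val t.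

Lemma time_itv t : 0 <= time t <= 1.
Proof. exact: (set_valP t). Qed.

Lemma clamp_le0 t : t <= 0 -> time (clamp t) = 0.
Proof.
by move=> t0; rewrite /time /clamp set_valE /= min_l ?max_l // (le_trans t0).
Qed.

Lemma clamp_ge1 t : 1 <= t -> time (clamp t) = 1.
Proof. by move=> t1; rewrite /time /clamp set_valE /= min_r ?max_r. Qed.

Lemma continuous_time : continuous time.
Proof. exact: initial_continuous. Qed.

Lemma continuous_clamp : continuous clamp.
Proof.
apply: continuous_comp_initial => t.
apply: (@continuous_maxr R R (fun=> 0) (fun t => Num.min t 1)).
  exact: continuous_const.
by apply: continuous_minr; [move=> ?; exact: cvg_id|exact: continuous_const].
Qed.

Lemma near_lt (Z : topologicalType) (f g : Z -> R) z :
  continuous f -> continuous g -> f z < g z -> \forall z' \near z, f z' < g z'.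
Proof.
move=> cf cg fg; have h0 : 0 < g z - f z by rewrite subr_gt0.
have := continuous_sub cg cf => /(_ z) /(_ _ (lt_nbhsr h0)) ch.
by apply: (@filterS _ (nbhs z)) ch => z' /=; rewrite subr_gt0.
Qed.

Lemma homotopic_trans (X Y : topologicalType) (f g h : X -> Y) :
  homotopic R f g -> homotopic R g h -> homotopic R f h.
Proof.
move=> [H [cH [H0 H1]]] [G [cG [G0 G1]]].
exists (fun z => if time z.1 <= 2^-1 then H (clamp (2 * time z.1), z.2)
                 else G (clamp (2 * time z.1 - 1), z.2)).
have ct : continuous (fun z : unit_interval R * X => time z.1).
  by move=> z; apply: continuous_comp; [exact: cvg_fst|exact: continuous_time].
have c2t : continuous (fun z : unit_interval R * X => 2 * time z.1).
  by apply: continuous_mul => //; exact: continuous_const.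
have cF : continuous (fun z : unit_interval R * X => H (clamp (2 * time z.1), z.2)).
  move=> z; apply: continuous_comp; last exact: cH.
  apply: cvg_pair_at; last exact: cvg_snd.
  by apply: continuous_comp; [exact: c2t|exact: continuous_clamp].
have cK : continuous (fun z : unit_interval R * X =>
    G (clamp (2 * time z.1 - 1), z.2)).
  move=> z; apply: continuous_comp; last exact: cG.
  apply: cvg_pair_at; last exact: cvg_snd.
  apply: continuous_comp; last exact: continuous_clamp.
  by apply: (continuous_sub c2t); exact: continuous_const.
split; [|split].
- move=> z; apply: cvg_if_near => U.
    case: leP => tz nU.
      by apply: (@filterS _ (nbhs z)) (cF z U nU) => z' ?.
    have := near_lt (@continuous_const _ _ _) ct tz.
    by apply: (@filterS _ (nbhs z)) => z' + ?; rewrite ltNge => /negP.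
  case: leP => tz nU.
    have [tz'|/eqP tz'] := boolP (time z.1 == 2^-1); last first.
      have tz2 : time z.1 < 2^-1 by rewrite lt_neqAle tz andbT; apply/eqP.
      have := near_lt ct (@continuous_const _ _ _) tz2.
      by apply: (@filterS _ (nbhs z)) => z' /ltW + /negP.
    (* At the switching time both halves pass through [g], so the second branch converges to the
       value given by the first. *)
    have e : H (clamp (2 * time z.1), z.2) = G (clamp (2 * time z.1 - 1), z.2).
      by rewrite H1 ?G0 // (eqP tz'); [apply: clamp_le0|apply: clamp_ge1]; lra.
    by rewrite e in nU; apply: (@filterS _ (nbhs z)) (cK z U nU) => z' ?.
  by apply: (@filterS _ (nbhs z)) (cK z U nU) => z' ?.
- move=> t x; rewrite -/(time t) => t0 /=; rewrite t0 ifT; last by rewrite invr_ge0 ler0n.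
  by apply: H0; apply: clamp_le0; lra.
- move=> t x; rewrite -/(time t) => t1 /=; rewrite t1 ifF; last by apply/negbTE; rewrite -ltNge; lra.
  by apply: G1; apply: clamp_ge1; lra.
Qed.

Lemma homotopic_comp (X X' Y Y' : topologicalType) (u : X' -> X) (v : Y -> Y')
    (f g : X -> Y) :
  continuous u -> continuous v -> homotopic R f g ->
  homotopic R (v \o f \o u) (v \o g \o u).
Proof.
move=> cu cv [H [cH [H0 H1]]].
exists (fun z => v (H (z.1, u z.2))); split; last first.
  by split=> t x tE /=; [rewrite H0|rewrite H1].
move=> z; apply: continuous_comp; last exact: cv.
apply: continuous_comp; last exact: cH.
apply: cvg_pair_at; first exact: cvg_fst.
by apply: continuous_comp; [exact: cvg_snd|exact: cu].
Qed.

Lemma contractible_homotopy_equivalent (X Y : topologicalType) :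
  homotopy_equivalent R X Y -> contractible R Y -> contractible R X.
Proof.
move=> [f [g [cf [cg [gf _]]]]] [y0 hY]; exists (g y0).
exact: homotopic_trans (homotopic_comp cf cg hY) gf.
Qed.

End Homotopies.

(** * Maps into and out of a finite wedge *)

Section Wedges.
Variables (R : realType) (I : choiceType) (X : I -> topologicalType).
Variable p0 : forall i, X i.
Hypothesis finI : finite_set [set: I].
Hypothesis closed_p0 : forall i, closed [set p0 i].

Lemma wedge_prod_lift i (x : X i) j :
  wedge_prod (wedge_lift p0 x) j = dfwith p0 i x j.
Proof. by rewrite /wedge_prod wedge_lift_funE //; exact: wedge_prod_pointE. Qed.

Lemma wedge_prod_sparse (c : forall i, X i) i :
  (forall j, j <> i -> c j = p0 j) -> wedge_prod (wedge_lift p0 (c i)) = c.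
Proof.
move=> ci; apply: functional_extensionality_dep => j; rewrite wedge_prod_lift.
have [->|/eqP ij] := eqVneq j i; first by rewrite dfwithin.
by rewrite dfwithout ?ci // eq_sym; apply/eqP.
Qed.

(** A finite wedge with closed base points embeds in the product: [wedge_prod] is injective and open
    onto its range. *)
Lemma wedge_continuous (Z : topologicalType) (f : Z -> wedge p0) :
  (forall i, continuous (fun z => wedge_prod (f z) i)) -> continuous f.
Proof.
move=> cf z U nU.
have Rfz : range (@wedge_prod I X p0) (wedge_prod (f z)) by exists (f z).
have /(nbhs_subspace_ex _ Rfz)[V nV VU] := wedge_prod_open finI closed_p0 nU.
have cF : (fun z' => wedge_prod (f z') : prod_topology X) @ z
    --> (wedge_prod (f z) : prod_topology X).
  apply/cvg_sup => i S [B [[W oW <-] /= Wi WS]].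
  have := cf i z W (open_nbhs_nbhs (conj oW Wi)).
  by apply: (@filterS _ (nbhs z)) => z' Wz'; exact: WS.
have := cF _ nV; apply: (@filterS _ (nbhs z)) => z' /= Vz'.
have [[w Uw /wedge_prod_inj <-] _] :
    ((@wedge_prod I X p0 @` U) `&` range (@wedge_prod I X p0)) (wedge_prod (f z')).
  by rewrite VU; split=> //; exists (f z').
by [].
Qed.

(** The base point may move during the homotopy, provided that it moves in the same way on all
    summands. *)
Lemma wedge_homotopic (Y : topologicalType) (f g : wedge p0 -> Y)
    (H : forall i, unit_interval R * X i -> Y) :
  (forall i, continuous (H i)) ->
  (forall t i j, H i (t, p0 i) = H j (t, p0 j)) ->
  (forall t i x, time t = 0 -> H i (t, x) = f (wedge_lift p0 x)) ->
  (forall t i x, time t = 1 -> H i (t, x) = g (wedge_lift p0 x)) ->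
  homotopic R f g.
Proof.
move=> cH H0 Hf Hg.
exists (uncurry (fun t => wedge_fun (fun i x => H i (t, x)))); split.
  apply: (wedge_fun_joint_continuous finI closed_p0 H0) => i.
  by rewrite [uncurry _](_ : _ = H i) //; apply/funext => -[].
split=> t w tE; rewrite -[w](@reprK _ (wedge p0)); case: (repr w) => i x /=.
  by rewrite wedge_lift_funE /= ?Hf.
by rewrite wedge_lift_funE /= ?Hg.
Qed.

(** The summand containing [f z] is picked by choice, with no continuity in [z]; this is harmless
    because the image in the product is [c z] whatever the pick. *)
Lemma wedge_map (Z : topologicalType) (c : Z -> forall i, X i) :
  (forall z, exists i, forall j, j <> i -> c z j = p0 j) ->
  (forall i, continuous (fun z => c z i)) ->
  {f : Z -> wedge p0 | continuous f & forall z, wedge_prod (f z) = c z}.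
Proof.
move=> c1 cc.
pose f z : wedge p0 := wedge_lift p0 (c z (projT1 (cid (c1 z)))).
have fE z : wedge_prod (f z) = c z.
  by rewrite /f; case: (cid (c1 z)) => i ci; exact: wedge_prod_sparse.
exists f => //; apply: wedge_continuous => i.
by rewrite (_ : (fun z => _) = (fun z => c z i)) //; apply/funext => z; rewrite fE.
Qed.

End Wedges.

(** * Extending a contraction to the open cone *)

Definition down_closed (V : finType) (A : {set {set V}}) :=
  forall s t : {set V}, s \in A -> t \subset s -> t \in A.

Section ConeContraction.
Variables (R : realType) (V : finType) (A : {set {set V}}).
Implicit Types (x : V -> R) (a : R).

Lemma down_closed_set0 : down_closed A -> realization R A -> finset.set0 \in A.
Proof.
move=> dA q; have [_ _ qA] := coordP q.
by apply: dA qA _; apply/fintype.subsetP => v; rewrite inE.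
Qed.

Lemma mass_eq0 x : (forall v, 0 <= x v) -> \sum_v x v = 0 -> x = (fun=> 0).
Proof.
move=> x0 sx; apply/funext => v.
have /eqP := sx; rewrite psumr_eq0; last by move=> *; exact: x0.
by move/allP => /(_ v (mem_index_enum v)) /eqP.
Qed.

Variables (p : realization R A) (h : unit_interval R * realization R A -> realization R A).

(* The contraction [h] of |A|, extended to the open cone on |A| by homogeneity,
   with its time clamped to [0, 1]; points outside the cone do not move. *)
Definition cone_flow a x v : R :=
  if `[< realizable A x >]
  then (\sum_u x u) * coord (h (clamp a, normalize p x)) v else x v.
End ConeContraction.

Section ConeContraction.
Variables (R : realType) (V : finType) (A : {set {set V}}).
Implicit Types (x : V -> R) (a c e : R).

Variables (p q0 : realization R A)
  (h : unit_interval R * realization R A -> realization R A).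
Hypothesis dA : down_closed A.
Hypothesis ch : continuous h.
Hypothesis h0 : forall t q, time t = 0 -> h (t, q) = q0.
Hypothesis h1 : forall t q, time t = 1 -> h (t, q) = q.

Lemma cone_flow_ge0 a x v : (forall u, 0 <= x u) -> 0 <= cone_flow p h a x v.
Proof.
move=> x0; rewrite /cone_flow; case: ifP => // _.
apply: mulr_ge0; first exact: sumr_ge0.
by have [/(_ v) ? _ _] := coordP (h (clamp a, normalize p x)).
Qed.

Lemma cone_flow_mass a x : \sum_v cone_flow p h a x v = \sum_v x v.
Proof.
rewrite /cone_flow; case: asboolP => // _; rewrite -mulr_sumr.
by have [_ -> _] := coordP (h (clamp a, normalize p x)); rewrite mulr1.
Qed.

Lemma cone_flow_supp a x : supp x \in A -> supp (cone_flow p h a x) \in A.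
Proof.
move=> xA; have [|xr] := boolP `[< realizable A x >]; last first.
  suff -> : cone_flow p h a x = x by [].
  by apply/funext => v; rewrite /cone_flow (negbTE xr).
move=> xr; have [_ _] := coordP (h (clamp a, normalize p x)).
move=> qA; suff -> : supp (cone_flow p h a x) =
    supp (coord (h (clamp a, normalize p x))) by [].
apply/setP => v; rewrite !mem_supp /cone_flow xr mulf_eq0 negb_or.
by have /asboolP[_ /gt_eqF -> _] := xr.
Qed.

Lemma cone_flow_late a x v : 1 <= a -> cone_flow p h a x v = x v.
Proof.
move=> a1; rewrite /cone_flow; case: asboolP => // xr.
rewrite h1 ?clamp_ge1 // coord_normalize // mulrC divfK //.
by have [_ /gt_eqF -> _] := xr.
Qed.

(** If [x] is not realizable, its mass is 0 and both sides vanish, so the formula also covers the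
    apex of the open cone. *)
Lemma cone_flow_early a x v : a <= 0 -> (forall u, 0 <= x u) -> supp x \in A ->
  cone_flow p h a x v = (\sum_u x u) * coord q0 v.
Proof.
move=> a0 x0 xA; rewrite /cone_flow; case: asboolP => [_|xr].
  by rewrite h0 ?clamp_le0.
have /mass_eq0 sx0 : \sum_u x u = 0.
  apply/eqP; rewrite eq_le sumr_ge0 // andbT leNgt; apply/negP => sx.
  exact: xr.
by rewrite sx0 // big1 ?mul0r.
Qed.

(** Weight at [q0] may be added only once the flow has arrived at [q0]; otherwise the union of the
    two supports need not be a face. *)
Lemma cone_flow_supp_shift a x e : (forall u, 0 <= x u) -> supp x \in A ->
  e = 0 \/ a <= 0 -> supp (fun v => cone_flow p h a x v + e * coord q0 v) \in A.
Proof.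
move=> x0 xA [->|a0].
  rewrite (_ : supp _ = supp (cone_flow p h a x)); first exact: cone_flow_supp.
  by apply/setP => v; rewrite !mem_supp mul0r addr0.
have [_ _ /dA] := coordP q0; apply; apply/fintype.subsetP => v; rewrite !mem_supp.
by apply: contra_neq => qv; rewrite cone_flow_early // qv !mulr0 addr0.
Qed.

Lemma cone_flow_scale a x c v : 0 <= c -> (forall u, 0 <= x u) ->
  cone_flow p h a (fun u => c * x u) v = c * cone_flow p h a x v.
Proof.
move=> c_ge0 x0; have [->|c0] := eqVneq c 0.
  rewrite mul0r /cone_flow; case: ifP => _; rewrite ?mul0r //.
  by rewrite big1 ?mul0r // => u _; rewrite mul0r.
have c_gt0 : 0 < c by rewrite lt_neqAle eq_sym c0.
have sE : supp (fun u => c * x u) = supp x.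
  by apply/setP => u; rewrite !mem_supp mulf_eq0 negb_or c0.
have rE : realizable A (fun u => c * x u) <-> realizable A x.
  rewrite /realizable sE -mulr_sumr; split=> -[_ sx xA]; split => //.
  - by rewrite pmulr_rgt0 in sx.
  - by move=> u; rewrite mulr_ge0.
  - by rewrite mulr_gt0.
rewrite /cone_flow; case: asboolP => cr; case: asboolP => xr //;
  try by case: xr; apply/rE.
  rewrite -mulr_sumr -mulrA; congr (_ * (_ * coord (h (_, _)) v)).
  exact/esym/(@normalize_scale _ _ _ _ _ _ c).
by case: cr; apply/rE.
Qed.

(** The last hypothesis allows [x z] to leave the cone on A, but only where the flow has already
    become the identity. *)
Lemma cone_flow_continuous (Z : topologicalType) (a : Z -> R) (x : Z -> V -> R) v :
  continuous a -> (forall u, continuous (x ^~ u)) ->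
  (forall z u, 0 <= x z u) -> (forall z, supp (x z) \in A \/ 1 <= a z) ->
  continuous (fun z => cone_flow p h (a z) (x z) v).
Proof.
move=> ca cx x0 xA z.
change ((fun z' => cone_flow p h (a z') (x z') v) @ z
  --> cone_flow p h (a z) (x z) v).
have cs : continuous (fun z' => \sum_u x z' u) by exact: continuous_bigsum.
(* At mass 0 the normalised vector has no limit; but the flow preserves mass, so each coordinate is
   squeezed between 0 and the mass. *)
have [sx0|sx0] := eqVneq (\sum_u x z u) 0.
  have fz0 : cone_flow p h (a z) (x z) v = 0.
    suff /mass_eq0 -> : \sum_u cone_flow p h (a z) (x z) u = 0 => //.
      by move=> u; exact: cone_flow_ge0.
    by rewrite cone_flow_mass.
  rewrite fz0.
  apply: (@squeeze_cvgr _ _ _ _ (fun=> 0) (fun z' => \sum_u x z' u)).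
  - apply: nearW => z'; rewrite cone_flow_ge0 //=.
    rewrite -(cone_flow_mass (a z')) (bigD1 v) //= lerDl sumr_ge0 // => u _.
    exact: cone_flow_ge0.
  - exact: cvg_cst.
  - by rewrite -[X in _ --> X]sx0; exact: cs.
have sx_gt0 : 0 < \sum_u x z u by rewrite lt_neqAle eq_sym sx0 sumr_ge0.
have near_pos : \forall z' \near z, 0 < \sum_u x z' u.
  exact: (near_lt (@continuous_const _ _ _) cs sx_gt0).
(* Supports can only grow nearby. As A is down-closed, a support outside A stays outside A, and
   there the flow is the identity. *)
have near_supp : \forall z' \near z, supp (x z) \subset supp (x z').
  have : \forall z' \near z, forall u, u \in supp (x z) -> 0 < x z' u.
    apply: filter_forall => u.
    have [xu|xu] := eqVneq (x z u) 0.
      by apply: nearW => z'; rewrite mem_supp xu eqxx.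
    have xu0 : 0 < x z u by rewrite lt_neqAle eq_sym xu x0.
    have := near_lt (@continuous_const _ _ _) (cx u) xu0.
    by apply: filterS => z' ?.
  apply: filterS => z' H; apply/fintype.subsetP => u /H.
  by rewrite mem_supp => /gt_eqF ->.
have [xzA|xzA] := boolP (supp (x z) \in A); last first.
  rewrite /cone_flow; apply: cvg_if_near => U nU.
    apply: filterS near_supp => z' sz /asboolP[_ _ /dA /(_ sz)].
    by rewrite (negbTE xzA).
  case: asboolP nU => [[_ _]|_ nU]; first by rewrite (negbTE xzA).
  by apply: (@filterS _ (nbhs z)) (cx v z U nU) => z' ?.
have xzr : realizable A (x z) by split.
(* Unrealizable neighbours are replaced by [x z], since [normalize_cvg] asks for realizable vectors
   throughout. *)
pose g z' := normalize p (if `[< realizable A (x z') >] then x z' else x z).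
have cg : g @ z --> g z.
  apply: normalize_cvg => [z'|u]; first by case: asboolP.
  apply: cvg_trans (_ : (fun z' => if `[< realizable A (x z') >] then x z' u
    else x z u) @ z --> _); first by apply: near_eq_cvg; apply: nearW => z'; case: ifP.
  case: asboolP => // _; apply: cvg_if_near => U nU.
    by apply: (@filterS _ (nbhs z)) (cx u z U nU) => z' ?.
  by apply: nearW => z' _; exact: nbhs_singleton.
have gE z' : realizable A (x z') -> g z' = normalize p (x z').
  by rewrite /g => xr; case: asboolP.
have cF : (fun z' => (\sum_u x z' u) * coord (h (clamp (a z'), g z')) v) @ z
    --> (\sum_u x z u) * coord (h (clamp (a z), g z)) v.
  apply: cvgM; first exact: cs.
  apply: (@continuous_comp _ _ _ (fun z' => h (clamp (a z'), g z')) (fun q => coord q v)).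
    apply: continuous_comp; last exact: ch.
    apply: cvg_pair_at => //.
    by apply: continuous_comp; [exact: ca|exact: continuous_clamp].
  exact: continuous_coord.
have fE : cone_flow p h (a z) (x z) v = (\sum_u x z u) * coord (h (clamp (a z), g z)) v.
  by rewrite /cone_flow; case: asboolP => // _; rewrite gE.
rewrite {1}/cone_flow; apply: cvg_if_near => U nU.
  rewrite fE in nU; apply: (@filterS _ (nbhs z)) (cF U nU) => z' Uz /asboolP xr.
  by rewrite -gE.
have [a1|a1] := ltP (a z) 1.
  have na := near_lt ca (@continuous_const _ _ _) a1.
  apply: filterS2 na near_pos => z' a1' s' /asboolP[]; split => //.
  by case: (xA z') => //; rewrite leNgt a1'.
rewrite cone_flow_late // in nU.
by apply: (@filterS _ (nbhs z)) (cx v z U nU) => z' ?.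
Qed.

End ConeContraction.

(** * Suspensions *)

Section PositivePart.
Variable R : realType.
Implicit Types t : R.

Definition pos t := Num.max 0 t.

Lemma posP t : (t <= 0 /\ pos t = 0) \/ (0 < t /\ pos t = t).
Proof.
by rewrite /pos; case: (leP t 0) => t0; [left|right]; split=> //; rewrite ?max_l ?max_r // ltW.
Qed.

Lemma pos_le0 t : t <= 0 -> pos t = 0.
Proof. by case: (posP t) => -[] //; lra. Qed.

Lemma pos_ge0E t : 0 <= t -> pos t = t.
Proof. by case: (posP t) => -[] //; lra. Qed.

Lemma pos_ge0 t : 0 <= pos t.
Proof. by case: (posP t) => -[]; lra. Qed.

Lemma continuous_pos (Z : topologicalType) (f : Z -> R) :
  continuous f -> continuous (fun z => pos (f z)).
Proof. by move=> cf; apply: continuous_maxr => //; exact: continuous_const. Qed.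

Lemma eq_realizable (V : finType) (D : {set {set V}}) (x y : V -> R) :
  x =1 y -> realizable D x -> realizable D y.
Proof. by move=> /funext ->. Qed.

Lemma sub_realizable (V : finType) (D D' : {set {set V}}) (x : V -> R) :
  (forall s, s \in D -> s \in D') -> realizable D x -> realizable D' x.
Proof. by move=> DD' [x0 sx /DD']; split. Qed.

End PositivePart.

Section Suspension.
Variables (R : realType) (V : finType) (B : {set {set V}}).
Implicit Types (y : V -> R) (c w : R).

(* The height [w] is negative on the southern and positive on the northern half. *)
Definition susp_vec c y w (u : V + bool) : R :=
  match u with
  | inl v => c * y v
  | inr true => pos w
  | inr false => pos (- w)
  end.

Lemma big_susp (F : V + bool -> R) :
  \sum_u F u = (\sum_v F (inl v)) + (F (inr true) + F (inr false)).
Proof. by rewrite big_sumType /= big_bool. Qed.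

Lemma susp_vec_realizable c y w : finset.set0 \in B ->
  0 <= c -> (forall v, 0 <= y v) -> c = 0 \/ supp y \in B ->
  0 < c * (\sum_v y v) + `|w| -> realizable (susp B) (susp_vec c y w).
Proof.
move=> B0 c0 y0 yB s0; split.
- by case=> [v|[]] /=; rewrite ?pos_ge0 // mulr_ge0.
- rewrite big_susp /= -mulr_sumr.
  suff -> : pos w + pos (- w) = `|w| by [].
  by case: (posP w) => -[w0 ->]; case: (posP (- w)) => -[w1 ->];
     rewrite ?(gtr0_norm w0) ?(ler0_norm w0); lra.
rewrite inE; apply/andP; split.
  have [c_eq0|cN0] := eqVneq c 0.
    rewrite (_ : _ @^-1: _ = finset.set0) //.
    by apply/setP => v; rewrite !inE /= c_eq0 mul0r eqxx.
  rewrite (_ : _ @^-1: _ = supp y).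
    by case: yB => // cE; rewrite cE eqxx in cN0.
  by apply/setP => v; rewrite !inE /= mulf_eq0 negb_or cN0.
have [w0|w0] := leP w 0.
  rewrite -(cards1 false) subset_leq_card //; apply/fintype.subsetP => -[];
    by rewrite !inE //= pos_le0 // eqxx.
rewrite -(cards1 true) subset_leq_card //; apply/fintype.subsetP => -[];
  by rewrite !inE //= pos_le0 ?eqxx //; lra.
Qed.

Lemma susp_coordP (q : realization R (susp B)) :
  [/\ forall v, 0 <= coord q (inl v),
      0 <= coord q (inr true) /\ 0 <= coord q (inr false),
      coord q (inr true) = 0 \/ coord q (inr false) = 0,
      \sum_v coord q (inl v) = 1 - coord q (inr true) - coord q (inr false) &
      supp (fun v => coord q (inl v)) \in B].
Proof.
have [q0 q1 qB] := coordP q; move: qB; rewrite inE => /andP[qB qc].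
split=> //.
- have [qt|qt] := eqVneq (coord q (inr true)) 0; first by left.
  have [qf|qf] := eqVneq (coord q (inr false)) 0; first by right.
  suff E : inr @^-1: supp (coord q) = [set: bool]%SET.
    by move: qc; rewrite E cardsT card_bool.
  by apply/setP => -[]; rewrite !inE.
- by move: q1; rewrite big_susp => <-; lra.
- rewrite (_ : supp _ = inl @^-1: supp (coord q)) //.
  by apply/setP => v; rewrite !inE.
Qed.

Lemma continuous_susp_vec (Z : topologicalType) (c w : Z -> R) (y : Z -> V -> R) u :
  continuous c -> continuous w -> (forall v, continuous (y ^~ v)) ->
  continuous (fun z => susp_vec (c z) (y z) (w z) u).
Proof.
move=> cc cw cy; case: u => [v|[]] /=; first exact: continuous_mul.
  exact: continuous_pos.
by apply: continuous_pos; exact: continuous_opp.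
Qed.

Hypothesis B0 : finset.set0 \in B.

Lemma south_realizable : realizable (susp B) (susp_vec 0 (fun=> 0) (-1)).
Proof. by apply: susp_vec_realizable => //; [left|rewrite mul0r add0r normrN1 ltr01]. Qed.

Definition south : realization R (susp B) := point_of south_realizable.

Lemma coord_south u : coord south u = (u == inr false)%:R.
Proof.
rewrite coord_point_of big_susp /= big1 => [|v _]; last by rewrite mul0r.
rewrite (@pos_le0 _ (-1)) ?lerN10 // opprK pos_ge0E ?ler01 // !add0r divr1.
case: u => [v|[]] /=; first by rewrite mul0r.
  by rewrite pos_le0 ?lerN10.
by rewrite opprK pos_ge0E.
Qed.

Lemma normalize_south p c y w : w < 0 -> (forall v, c * y v = 0) ->
  normalize p (susp_vec c y w) = south.
Proof.
move=> w0 cy.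
have E : susp_vec c y w =1 susp_vec 0 (fun=> 0) w.
  by case=> [v|[]] //=; rewrite cy mul0r.
rewrite (eq_normalize _ E) -(normalize_coord p south).
apply: (@normalize_scale _ _ _ _ _ _ (- w^-1)).
- apply: susp_vec_realizable => //; first by left.
  by rewrite mul0r add0r normr_gt0 lt_eqF.
- exact: coord_realizable.
case=> [v|[]]; rewrite coord_south /= ?mul0r ?mulr0 //.
  by rewrite pos_le0 ?mulr0 // ltW.
by rewrite pos_ge0E ?mulrNN ?mulVf ?lt_eqF // oppr_ge0 ltW.
Qed.

End Suspension.

(** * Attaching cones along subcomplexes of a contractible complex *)

Section ConesOverContractible.
Variables (R : realType) (T : finType) (K : {set T}).
Variables (A Y D : {set {set T}}) (L : T -> {set {set T}}).
Hypothesis dA : down_closed A.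
Hypothesis AY : forall s, s \in A -> s \in Y.
Hypothesis YK : forall s v, s \in Y -> v \in s -> v \notin K.
Hypothesis L0 : forall k, k \in K -> finset.set0 \in L k.
Hypothesis LA : forall k s, k \in K -> s \in L k -> s \in A.
Hypothesis DP : forall s, s \in D <->
  s \in Y \/ exists k t, [/\ k \in K, t \in L k & s = k |: t].
Variables (q0 : realization R A)
  (h : unit_interval R * realization R A -> realization R A).
Hypothesis ch : continuous h.
Hypothesis h0 : forall t q, time t = 0 -> h (t, q) = q0.
Hypothesis h1 : forall t q, time t = 1 -> h (t, q) = q.

Implicit Types (a c t : R) (x y : T -> R) (k v : T).

Local Notation flow := (cone_flow q0 h).

Let YD s : s \in Y -> s \in D.
Proof. by move=> sY; apply/DP; left. Qed.

Lemma AK s v : s \in A -> v \in s -> v \notin K.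
Proof. by move=> /AY; exact: YK. Qed.

Lemma supp_out y k : supp y \in Y -> k \in K -> y k = 0.
Proof.
move=> yY kK; apply/eqP; rewrite -[_ == 0]negbK -mem_supp.
by apply/negP => /(YK yY); rewrite kK.
Qed.

Lemma cone_vec_realizable a y c : (forall v, 0 <= y v) -> supp y \in A ->
  0 <= c -> c = 0 \/ a <= 0 -> 0 < \sum_v y v + c ->
  realizable A (fun v => flow a y v + c * coord q0 v).
Proof.
move=> y0 yA c0 ca s0; have [p0 p1 pA] := coordP q0; split.
- by move=> v; rewrite addr_ge0 ?cone_flow_ge0 ?mulr_ge0.
- by rewrite big_split /= cone_flow_mass -mulr_sumr p1 mulr1.
exact: cone_flow_supp_shift.
Qed.

(** With apex weight, the base part has to be a face of [L k], not merely of A; this is ensured by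
    the flow being finished and no weight having been put at [q0]. *)
Lemma apex_vec_realizable k a y c (e : R) : k \in K ->
  (forall v, 0 <= y v) -> supp y \in L k -> 0 <= c -> 0 <= e ->
  c = 0 \/ a <= 0 -> e = 0 \/ (1 <= a /\ c = 0) ->
  0 < \sum_v y v + c + e ->
  realizable D (fun v => flow a y v + c * coord q0 v + e * (v == k)%:R).
Proof.
move=> kK y0 yL c0 e0 ca ea s0; have yA := LA kK yL.
have [e_eq0|eN0] := eqVneq e 0.
  rewrite e_eq0 addr0 in s0.
  have := cone_vec_realizable y0 yA c0 ca s0.
  move/(sub_realizable (fun s sA => YD (AY sA))).
  by apply: eq_realizable => v; rewrite e_eq0 mul0r addr0.
case: ea => [/eqP|[a1 c_eq0]]; first by rewrite (negbTE eN0).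
apply: (@eq_realizable _ _ _ (fun v => y v + e * (v == k)%:R)) => [v|].
  by rewrite (cone_flow_late _ h1) // c_eq0 mul0r addr0.
split.
- by move=> v; rewrite addr_ge0 // mulr_ge0 // ler0n.
- rewrite big_split /= -mulr_sumr [X in _ * X](bigD1 k) //= eqxx [X in _ * (_ + X)]big1 => [|v /negbTE -> //].
  by rewrite addr0 mulr1; rewrite c_eq0 addr0 in s0.
apply/DP; right; exists k, (supp y); split=> //.
have yk : y k = 0 by apply: supp_out => //; exact: AY.
apply/setP => v; rewrite !inE; have [->|vk] := eqVneq v k.
  by rewrite yk add0r mulr1 eN0.
by rewrite mulr0 addr0.
Qed.

(** * Base part and height of a point, and piecewise-linear profiles of the height *)

Definition low x v : R := if v \in K then 0 else x v.
(** On each cone this is the weight of its apex. Summing over all of [K] makes the base formulas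
    independent of the cone, so their continuity needs no gluing. *)
Definition wt x : R := \sum_(k in K) x k.

Lemma low_ge0 x v : (forall v, 0 <= x v) -> 0 <= low x v.
Proof. by move=> x0; rewrite /low; case: ifP. Qed.

Lemma sum_low x : \sum_v low x v = \sum_v x v - wt x.
Proof.
rewrite (bigID (mem K) _ x) /= -/(wt x) addrC addrK.
rewrite [RHS]big_mkcond; apply: eq_bigr => v _; rewrite /low.
by case: (v \in K).
Qed.

Variant cone_spec (x : realization R D) : Prop :=
| InBase of (forall k, k \in K -> coord x k = 0) & supp (coord x) \in Y
  & wt (coord x) = 0 & low (coord x) =1 coord x
| InCone k of k \in K & 0 < coord x k & coord x k <= 1 &
  (forall j, j \in K -> j != k -> coord x j = 0) &
  supp (low (coord x)) \in L k & wt (coord x) = coord x k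
  & \sum_v low (coord x) v = 1 - coord x k.

(** The faces of A, and so those of [L k], avoid [K]; off the base exactly one apex coordinate is
    therefore nonzero. *)
Lemma coneP (x : realization R D) : cone_spec x.
Proof.
have [x0 x1 /DP[xY|[k [t [kK tL xE]]]]] := coordP x.
  have xK k : k \in K -> coord x k = 0 by exact: supp_out.
  apply: InBase => //; first by rewrite /wt big1.
  by move=> v; rewrite /low; case: ifP => // /xK.
have xk : 0 < coord x k.
  by rewrite lt_neqAle eq_sym x0 andbT -mem_supp xE !inE eqxx.
have xj j : j \in K -> j != k -> coord x j = 0.
  move=> jK jk; apply/eqP; rewrite -[_ == 0]negbK -mem_supp xE !inE (negbTE jk) /=.
  by apply/negP => /(AK (LA kK tL)); rewrite jK.
have wE : wt (coord x) = coord x k.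
  by rewrite /wt (bigD1 k) //= big1 ?addr0 // => j /andP[]; exact: xj.
have sE : \sum_v low (coord x) v = 1 - coord x k by rewrite sum_low x1 wE.
apply: (@InCone x k) => //.
  by rewrite -subr_ge0 -sE sumr_ge0 // => v _; exact: low_ge0.
rewrite (_ : supp _ = t) //; apply/setP => v; rewrite mem_supp /low.
case: ifP => vK; last first.
  by rewrite -mem_supp xE !inE; case: eqP => // vk; rewrite vk kK in vK.
rewrite eqxx; apply/esym/negP => vt.
by have := AK (LA kK tL) vt; rewrite vK.
Qed.

(** Ramp from 0 at height 1/2 to 1 at height 3/4. It weights the base part of the image in the
    suspension, which must vanish while that image rests at the south pole. *)
Definition collapse (s : R) : R := pos (4 * s - 2) - pos (4 * s - 3).

Lemma collapse_early (s : R) : s <= 2^-1 -> collapse s = 0.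
Proof. by move=> hs; rewrite /collapse !pos_le0; lra. Qed.

Lemma collapse_late (s : R) : 3 / 4 <= s -> collapse s = 1.
Proof. by move=> hs; rewrite /collapse !pos_ge0E; lra. Qed.

Lemma collapse_gt0 (s : R) : 2^-1 < s -> 0 < collapse s.
Proof.
by move=> hs; rewrite /collapse pos_ge0E; case: (posP (4 * s - 3)) => -[] *; lra.
Qed.

Lemma collapse_ge0 (s : R) : 0 <= collapse s.
Proof.
have [/collapse_early ->//|/collapse_gt0/ltW//] := leP s 2^-1.
Qed.

(* Mass of the unnormalised image in the suspension of the point of height [s]. *)
Definition den (s : R) : R := collapse s * (1 - s) + `|4 * s - 3|.

(** The two nonnegative terms have no common zero: the second vanishes only at 3/4, where the first
    is 1/4. *)
Lemma den_gt0 (s : R) : s <= 1 -> 0 < den s.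
Proof.
move=> s1; rewrite /den; have c0 := collapse_ge0 s.
have [sE|sN] := eqVneq s (3 / 4).
  have := @collapse_gt0 s; rewrite sE => /(_ ltac:(lra)) cp.
  by apply: ltr_wpDr => //; rewrite mulr_gt0 //; lra.
apply: ltr_wpDl; first by apply: mulr_ge0 => //; rewrite subr_ge0.
by rewrite normr_gt0; apply: contra_neq sN; lra.
Qed.

(** The weight of the south pole in the normalised image of a point of height [s]. *)
Definition south_weight (s : R) : R := pos (3 - 4 * s) / den s.

Lemma south_weight_early (s : R) : s <= 2^-1 -> south_weight s = 1.
Proof.
move=> hs; rewrite /south_weight /den collapse_early // mul0r add0r ler0_norm; last lra.
by rewrite pos_ge0E ?opprB ?divff //; lra.
Qed.

Lemma south_weight_late (s : R) : 3 / 4 <= s -> south_weight s = 0.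
Proof. by move=> hs; rewrite /south_weight pos_le0 ?mul0r //; lra. Qed.

Lemma south_weight_le1 (s : R) : s <= 1 -> south_weight s <= 1.
Proof.
move=> s1; rewrite /south_weight ler_pdivrMr ?den_gt0 // mul1r /den.
have c0 : 0 <= collapse s * (1 - s) by rewrite mulr_ge0 ?collapse_ge0 //; lra.
by case: (posP (3 - 4 * s)) => -[hs ->]; rewrite ?addr_ge0 // ler0_norm; lra.
Qed.

Lemma continuous_collapse (Z : topologicalType) (f : Z -> R) :
  continuous f -> continuous (fun z => collapse (f z)).
Proof.
move=> cf; apply: continuous_sub; apply: continuous_pos; apply: continuous_sub;
  by [apply: continuous_mul => //; exact: continuous_const|exact: continuous_const].
Qed.

Lemma continuous_south_weight (Z : topologicalType) (f : Z -> R) :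
  (forall z, f z <= 1) -> continuous f -> continuous (fun z => south_weight (f z)).
Proof.
move=> f1 cf; have c4 : continuous (fun z => 4 * f z).
  by apply: continuous_mul => //; exact: continuous_const.
apply: continuous_mul.
  by apply: continuous_pos; apply: continuous_sub => //; exact: continuous_const.
apply: continuous_inv => [z|]; first by rewrite gt_eqF ?den_gt0.
apply: continuous_add.
  apply: continuous_mul; first exact: continuous_collapse.
  by apply: continuous_sub => //; exact: continuous_const.
move=> z; apply: (@continuous_comp _ _ _ (fun z => 4 * f z - 3) Num.norm).
  by apply: continuous_sub => //; exact: continuous_const.
exact: norm_continuous.
Qed.

(* Time of the contraction during the round trip of a point of height [s]: it goes
   from 1 at [s = 0] down to 0 near [s = 1/2] and is back at 1 for [s >= 3/4]. *)
Definition turn_time (s : R) : R := Num.max (1 - 2 * s) (1 - 2 * south_weight s).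

Lemma turn_time_early (s : R) : 0 <= s -> s <= 2^-1 -> turn_time s = 1 - 2 * s.
Proof. by move=> s0 hs; rewrite /turn_time south_weight_early // max_l //; lra. Qed.

Lemma turn_time_late (s : R) : 0 <= s -> 3 / 4 <= s -> turn_time s = 1.
Proof. by move=> s0 hs; rewrite /turn_time south_weight_late // max_r //; lra. Qed.

Lemma turn_time_geN1 (s : R) : s <= 1 -> -1 <= turn_time s.
Proof.
by move=> /south_weight_le1 sw; rewrite /turn_time le_max; apply/orP; right; lra.
Qed.

(* The map to the wedge, in coordinates: on the cone over [k] at height [s], [to_base]
   follows the contraction as [s] grows to 1/2 and then stays at [q0]; [to_susp] stays
   at the south pole up to 1/2, crosses the equator at 3/4 and ends at the north pole. *)
Definition to_base x v : R :=
  flow (1 - 2 * wt x) (low x) v + pos (2 * wt x - 1) * coord q0 v.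

Definition to_susp k x : T + bool -> R :=
  susp_vec (collapse (x k)) (low x) (4 * x k - 3).

(* The northern half of the suspension is the cone over [k]; on the southern half the
   contraction is run so as to arrive at [q0] midway to the pole. *)
Definition from_susp k (q : T + bool -> R) v : R :=
  flow (1 - 2 * q (inr false)) (fun v => q (inl v)) v
  + pos (2 * q (inr false) - 1) * coord q0 v + q (inr true) * (v == k)%:R.

(* Homotopy from the round trip on the complex ([t = 0]) to the identity ([t = 1]): the
   contraction is switched off first, and only then does the apex coordinate move. *)
Definition round_trip t x v : R :=
  flow (turn_time (wt x) + 4 * t) (low x) v +
  (if v \in K then (1 - t) * pos (4 * x v - 3) + pos (2 * t - 1) * x v else 0).

(* Homotopy from the round trip on a suspension ([t = 0]) to the identity ([t = 1]):
   by time 1/4 the base coordinate has reached [q0], and only after that may the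
   suspension coordinate leave the south pole on the southern part. *)
Definition susp_base t (q : T + bool -> R) v : R :=
  flow (Num.min (1 - 2 * q (inr false)) (1 - 2 * q (inr true)) - 4 * t)
    (fun v => q (inl v)) v
  + (pos (2 * q (inr false) - 1) + pos (2 * q (inr true) - 1)) * coord q0 v.

Definition susp_susp t (q : T + bool -> R) : T + bool -> R :=
  susp_vec ((1 - t) * collapse (q (inr true)) + pos (4 * t - 1))
    (fun v => q (inl v))
    ((1 - t) * (4 * q (inr true) - 3)
     + pos (4 * t - 1) * (q (inr true) - q (inr false))).

(** * The formulas land in their complexes *)

Lemma round_trip_cone t x k : k \in K -> (forall j, j \in K -> j != k -> x j = 0) ->
  round_trip t x =1 (fun v => flow (turn_time (wt x) + 4 * t) (low x) v
    + 0 * coord q0 v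
    + ((1 - t) * pos (4 * x k - 3) + pos (2 * t - 1) * x k) * (v == k)%:R).
Proof.
move=> kK xj v; rewrite /round_trip mul0r addr0; congr (_ + _).
have [->|vk] := eqVneq v k; first by rewrite kK mulr1.
rewrite mulr0; case: ifP => // vK; rewrite (xj v) // !mulr0 sub0r.
by rewrite pos_le0 ?mulr0 ?addr0 // oppr_le0.
Qed.

Lemma round_trip_base t x : 0 <= t -> (forall k, k \in K -> x k = 0) ->
  round_trip t x =1 x.
Proof.
move=> t0 xK v.
have w0 : wt x = 0 by rewrite /wt big1.
rewrite /round_trip w0 (cone_flow_late _ h1); last first.
  by rewrite turn_time_early //; lra.
rewrite /low; case: ifP => vK; last by rewrite addr0.
by rewrite xK // !mulr0 sub0r pos_le0 ?mulr0 ?addr0 // oppr_le0.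
Qed.

Lemma to_base_realizable (x : realization R D) : realizable Y (to_base (coord x)).
Proof.
have [x0 x1 _] := coordP x.
case: (coneP x) => [xK xY w0 lE|k kK xk xk1 xj xL wE sE].
  apply: (@eq_realizable _ _ _ (coord x)) => [v|]; last by split; rewrite ?x1.
  rewrite /to_base w0 (cone_flow_late _ h1) ?mulr0 ?subr0 //.
  by rewrite sub0r pos_le0 ?lerN10 // mul0r addr0 lE.
apply: (sub_realizable AY); apply: cone_vec_realizable.
- by move=> v; exact: low_ge0.
- exact: LA xL.
- exact: pos_ge0.
- by case: (posP (2 * wt (coord x) - 1)) => -[? ->]; [left|right; lra].
- by rewrite sE wE; case: (posP (2 * coord x k - 1)) => -[? ->]; lra.
Qed.

Lemma to_susp_realizable k (x : realization R D) : k \in K ->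
  realizable (susp (L k)) (to_susp k (coord x)).
Proof.
move=> kK; have [x0 x1 _] := coordP x.
have lx v : 0 <= low (coord x) v by exact: low_ge0.
apply: susp_vec_realizable => //; first exact: L0.
- exact: collapse_ge0.
- have [/collapse_early->|hs] := leP (coord x k) 2^-1; [by left|right].
  case: (coneP x) => [xK _ _ _|j jK _ _ xj xL _ _].
    by move: hs; rewrite xK //; lra.
  have [<- //|kj] := eqVneq j k.
  by move: hs; rewrite (xj k) // 1?eq_sym //; lra.
have [hs|hs] := eqVneq (coord x k) (3 / 4).
  have : 0 < collapse (coord x k) by apply: collapse_gt0; lra.
  case: (coneP x) => [xK _ _ _|j jK _ _ xj _ _ sE].
    by move: hs; rewrite xK //; lra.
  have [jk|kj] := eqVneq j k; last by move: hs; rewrite (xj k) // 1?eq_sym //; lra.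
  rewrite sE jk hs => c0; apply: ltr_wpDr => //; rewrite mulr_gt0 //; lra.
apply: ltr_wpDl; first by rewrite mulr_ge0 ?collapse_ge0 ?sumr_ge0.
by rewrite normr_gt0; apply: contra_neq hs; lra.
Qed.

Lemma from_susp_realizable k (q : realization R (susp (L k))) : k \in K ->
  realizable D (from_susp k (coord q)).
Proof.
move=> kK; have [y0 [n0 m0] nm s1 yL] := susp_coordP q.
apply: apex_vec_realizable => //; first exact: pos_ge0.
- by case: (posP (2 * coord q (inr false) - 1)) => -[? ->]; [left|right; lra].
- case: nm => [->|mE]; [by left|right].
  by rewrite mE mulr0 subr0 sub0r pos_le0 ?lerN10.
- by rewrite s1; case: (posP (2 * coord q (inr false) - 1)) => -[? ->]; lra.
Qed.

(** Apex weight appears only when the flow time is at least 1: above height 3/4 [turn_time] is 1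
    already, and for t > 1/2 the term 4t makes up for [turn_time] being as low as -1. *)
Lemma round_trip_realizable t (x : realization R D) : 0 <= t -> t <= 1 ->
  realizable D (round_trip t (coord x)).
Proof.
move=> t0 t1; have [x0 x1 _] := coordP x.
case: (coneP x) => [xK xY _ _|k kK xk xk1 xj xL wE sE].
  apply: (eq_realizable (fun v => esym (round_trip_base t0 xK v))).
  exact: coord_realizable.
apply: (eq_realizable (fun v => esym (round_trip_cone t kK xj v))).
have e0 : 0 <= (1 - t) * pos (4 * coord x k - 3).
  by rewrite mulr_ge0 ?pos_ge0 ?subr_ge0.
have e1 : 0 <= pos (2 * t - 1) * coord x k by rewrite mulr_ge0 ?pos_ge0 // ltW.
apply: apex_vec_realizable => //.
- by move=> v; exact: low_ge0.
- exact: addr_ge0.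
- by left.
- rewrite wE; case: (posP (4 * coord x k - 3)) => -[hx pE]; last first.
    by right; split=> //; rewrite turn_time_late //; lra.
  case: (posP (2 * t - 1)) => -[ht tE]; first by left; rewrite pE tE mulr0 mul0r addr0.
  by right; split=> //; have := turn_time_geN1 xk1; lra.
rewrite sE addr0; have [/eqP xk_eq1|xkN] := boolP (coord x k == 1); last first.
  by apply: ltr_wpDr; rewrite ?addr_ge0 // subr_gt0 lt_neqAle xkN.
rewrite xk_eq1 subrr add0r (pos_ge0E _) ?mulr1; last lra.
by case: (posP (2 * t - 1)) => -[? ->]; lra.
Qed.

Lemma susp_base_realizable k t (q : realization R (susp (L k))) : k \in K ->
  0 <= t -> realizable A (susp_base t (coord q)).
Proof.
move=> kK t0; have [y0 [n0 m0] nm s1 yL] := susp_coordP q.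
apply: cone_vec_realizable => //.
- exact: LA yL.
- by rewrite addr_ge0 ?pos_ge0.
- set m := coord q (inr false) in m0 nm s1 *; set n := coord q (inr true) in n0 nm s1 *.
  case: (posP (2 * m - 1)) => -[hm ->]; last first.
    by right; rewrite lerBlDr ge_min; apply/orP; left; lra.
  case: (posP (2 * n - 1)) => -[hn ->]; first by left; rewrite addr0.
  by right; rewrite lerBlDr ge_min; apply/orP; right; lra.
rewrite s1; case: (posP (2 * coord q (inr false) - 1)) => -[? ->];
  by case: (posP (2 * coord q (inr true) - 1)) => -[? ->]; case: nm => ?; lra.
Qed.

(** The vector never vanishes. If the base factor is 0, then n <= 1/2 and t <= 1/4, so the height is
    negative; if the base mass is 0, the point is a pole and both terms of the height agree in
    sign. *)
Lemma susp_susp_realizable k t (q : realization R (susp (L k))) : k \in K ->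
  0 <= t -> t <= 1 -> realizable (susp (L k)) (susp_susp t (coord q)).
Proof.
move=> kK t0 t1; have [y0 [n0 m0] nm s1 yL] := susp_coordP q.
rewrite /susp_susp.
set m := coord q (inr false) in m0 nm s1 *; set n := coord q (inr true) in n0 nm s1 *.
have c0 : 0 <= (1 - t) * collapse n by rewrite mulr_ge0 ?collapse_ge0 ?subr_ge0.
have p0 : 0 <= pos (4 * t - 1) by exact: pos_ge0.
have tp : 0 < (1 - t) + pos (4 * t - 1).
  by case: (posP (4 * t - 1)) => -[? ->]; lra.
have sy : 0 <= \sum_v coord q (inl v) by exact: sumr_ge0.
apply: susp_vec_realizable => //; [exact: L0|exact: addr_ge0|by right|].
have [hs|hs] := ltP 0 (((1 - t) * collapse n + pos (4 * t - 1)) * (\sum_v coord q (inl v))).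
  exact: ltr_wpDr.
apply: ltr_wpDl; first by rewrite mulr_ge0 ?addr_ge0.
rewrite normr_gt0.
have /orP[/eqP hc|/eqP hy] : ((1 - t) * collapse n + pos (4 * t - 1) == 0)
    || (\sum_v coord q (inl v) == 0).
  by rewrite -mulf_eq0 eq_le hs mulr_ge0 ?addr_ge0.
  have pE : pos (4 * t - 1) = 0 by lra.
  have t1' : 0 < 1 - t by lra.
  have : collapse n = 0.
    have /eqP : (1 - t) * collapse n = 0 by lra.
    by rewrite mulf_eq0 gt_eqF //= => /eqP.
  have [hn _|/collapse_gt0] := leP n 2^-1; last by move=> /gt_eqF ne E; rewrite E eqxx in ne.
  rewrite pE mul0r addr0; apply: mulf_neq0; first by rewrite gt_eqF.
  by rewrite lt_eqF // subr_lt0; lra.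
case: nm => E; rewrite E in s1 *.
  have mE : m = 1 by lra.
  by rewrite mE lt_eqF // !mulr0 !sub0r; nra.
have nE : n = 1 by lra.
by rewrite nE gt_eqF //; lra.
Qed.

Lemma base_realizable : realizable Y (coord q0).
Proof. exact: (sub_realizable AY (coord_realizable q0)). Qed.

Lemma total_realizable : realizable D (coord q0).
Proof. exact: (sub_realizable YD base_realizable). Qed.

(** * The two maps, one wedge coordinate at a time *)

Definition cone_summand (i : option {k : T | k \in K}) : topologicalType :=
  match i with
  | None => realization R Y
  | Some k => realization R (susp (L (val k)))
  end.

Definition cone_base (i : option {k : T | k \in K}) : cone_summand i :=
  match i return cone_summand i with
  | None => point_of base_realizable
  | Some k => south R (L0 (valP k))
  end.

Local Notation base_pt := (point_of base_realizable : realization R Y).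
Local Notation total_pt := (point_of total_realizable : realization R D).
Local Notation south_pt k := (south R (L0 (valP k))).

Lemma coord_base_pt : coord base_pt =1 coord q0.
Proof. by move=> v; rewrite coord_point_of; have [_ -> _] := coordP q0; rewrite divr1. Qed.

Lemma coord_total_pt : coord total_pt =1 coord q0.
Proof. by move=> v; rewrite coord_point_of; have [_ -> _] := coordP q0; rewrite divr1. Qed.

Lemma normalize_base_pt p x c : realizable Y x -> (forall v, x v = c * coord q0 v) ->
  normalize p x = base_pt.
Proof.
move=> xY xE; rewrite -(normalize_coord p base_pt) (eq_normalize _ coord_base_pt).
by apply/esym; apply: (normalize_scale _ base_realizable xY xE).
Qed.

Lemma cone_base_closed i : closed [set cone_base i].
Proof. by case: i => [k|]; exact: realization_closed1. Qed.

Definition to_wedge_coord (x : realization R D) i : cone_summand i :=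
  match i return cone_summand i with
  | None => normalize base_pt (to_base (coord x))
  | Some k => normalize (south_pt k) (to_susp (val k) (coord x))
  end.

Lemma to_wedge_coord_base (x : realization R D) : 2^-1 < wt (coord x) ->
  to_wedge_coord x None = cone_base None.
Proof.
move=> hw; rewrite /=.
case: (coneP x) => [_ _ w0|k kK xk xk1 xj xL wE sE]; first by exfalso; rewrite w0 in hw; lra.
apply: (@normalize_base_pt _ _ (1 - coord x k + pos (2 * coord x k - 1))).
  exact: to_base_realizable.
move=> v; have [x0 _ _] := coordP x.
rewrite /to_base (cone_flow_early _ h0); last 3 first.
- by rewrite wE in hw *; lra.
- by move=> u; exact: low_ge0.
- exact: LA xL.
by rewrite sE wE [RHS]mulrDl.
Qed.

Lemma to_wedge_coord_south (x : realization R D) (k : {k : T | k \in K}) : coord x (val k) <= 2^-1 ->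
  to_wedge_coord x (Some k) = cone_base (Some k).
Proof.
move=> xk; apply: normalize_south; first lra.
by move=> v; rewrite collapse_early ?mul0r.
Qed.

(** Height 1/2 is the switch: up to it all suspension coordinates are south poles, beyond it the
    base coordinate is [q0]. *)
Lemma to_wedge_coord_sparse (x : realization R D) :
  exists i, forall j, j <> i -> to_wedge_coord x j = cone_base j.
Proof.
case: (coneP x) => [xK _ _ _|k kK xk xk1 xj xL wE sE].
  by exists None; case=> // k _; apply: to_wedge_coord_south; rewrite xK ?invr_ge0 ?(valP k).
have [xk2|xk2] := leP (coord x k) 2^-1.
  exists None; case=> // j _; apply: to_wedge_coord_south.
  have [->//|jk] := eqVneq (val j) k; rewrite xj ?invr_ge0 //; exact: (valP j).
exists (Some (exist _ k kK)) => -[j jk|_]; last by apply: to_wedge_coord_base; rewrite wE.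
apply: to_wedge_coord_south; rewrite xj ?invr_ge0 //; first exact: (valP j).
by apply/eqP => jE; apply: jk; congr Some; apply: val_inj.
Qed.

Definition from_wedge_coord i : cone_summand i -> realization R D :=
  match i return cone_summand i -> realization R D with
  | None => fun q => normalize total_pt (coord (q : realization R Y))
  | Some k => fun q => normalize total_pt
      (from_susp (val k) (coord (q : realization R (susp (L (val k))))))
  end.

Lemma from_susp_south (k : {k : T | k \in K}) : from_susp (val k) (coord (south_pt k)) =1 coord q0.
Proof.
move=> v; rewrite /from_susp !coord_south /= !mulr1 mul0r addr0.
rewrite (cone_flow_early _ h0); last 3 first.
- by lra.
- by move=> u; rewrite coord_south.
- have -> : supp (fun u => coord (south_pt k) (inl u)) = finset.set0.
    by apply/setP => u; rewrite mem_supp coord_south eqxx inE.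
  by apply: LA (L0 (valP k)); exact: valP.
rewrite big1 => [|u _]; last by rewrite coord_south.
by rewrite mul0r add0r pos_ge0E; [rewrite -[RHS]mul1r; congr (_ * _); lra|lra].
Qed.

Lemma from_wedge_coord_base i : from_wedge_coord (cone_base i) = total_pt.
Proof.
case: i => [k|] /=; rewrite -[RHS](normalize_coord total_pt); apply: eq_normalize => v.
  by rewrite from_susp_south coord_total_pt.
by rewrite coord_base_pt coord_total_pt.
Qed.

Section Continuity.
Variable Z : topologicalType.

Lemma continuous_wt (x : Z -> T -> R) :
  (forall v, continuous (x ^~ v)) -> continuous (fun z => wt (x z)).
Proof. by move=> cx; apply: continuous_bigsum => k _; exact: cx. Qed.

Lemma continuous_low (x : Z -> T -> R) :
  (forall v, continuous (x ^~ v)) -> forall v, continuous (fun z => low (x z) v).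
Proof.
move=> cx v; rewrite /low; case: (v \in K); [exact: continuous_const|exact: cx].
Qed.

End Continuity.

Lemma to_wedge_coord_continuous i : continuous (fun x : realization R D => to_wedge_coord x i).
Proof.
have cx v : continuous (fun x : realization R D => coord x v) by exact: continuous_coord.
have cw := continuous_wt cx.
case: i => [k|] /=.
  apply: normalize_continuous => [x|u]; first exact: to_susp_realizable (valP k).
  apply: continuous_susp_vec; last exact: continuous_low.
    exact: continuous_collapse.
  exact: continuous_affine.
apply: normalize_continuous => [x|v]; first exact: to_base_realizable.
apply: continuous_add.
  apply: (cone_flow_continuous dA ch h1).
  - exact: continuous_coaffine.
  - exact: continuous_low.
  - by move=> x u; apply: low_ge0; have [] := coordP x.
  (* A base point may lie outside A, but its height is 0, so its flow time is 1. *)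
  - move=> x; case: (coneP x) => [_ _ -> _|k kK _ _ _ xL _ _].
      by right; rewrite mulr0 subr0.
    by left; exact: LA xL.
apply: continuous_mul; last exact: continuous_const.
by apply: continuous_pos; exact: continuous_affine.
Qed.

Lemma from_wedge_coord_continuous i : continuous (@from_wedge_coord i).
Proof.
case: i => [k|] /=; apply: normalize_continuous.
- by move=> q; exact: from_susp_realizable (valP k).
- move=> v; have cq u : continuous (fun q : realization R (susp (L (val k))) => coord q u).
    exact: continuous_coord.
  apply: continuous_add; last first.
    by apply: continuous_mul => //; exact: continuous_const.
  apply: continuous_add.
    apply: (cone_flow_continuous dA ch h1).
    + exact: continuous_coaffine.
    + by move=> u; exact: cq.
    + by move=> q u; have [] := susp_coordP q.
    + by move=> q; left; have [_ _ _ _] := susp_coordP q; apply: LA; exact: valP.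
  apply: continuous_mul; last exact: continuous_const.
  by apply: continuous_pos; exact: continuous_affine.
- by move=> y; apply: (sub_realizable YD); exact: coord_realizable.
- by move=> v; exact: continuous_coord.
Qed.

Lemma to_susp_mass (x : realization R D) k : coord x k <= 1 ->
  \sum_v low (coord x) v = 1 - coord x k ->
  \sum_u to_susp k (coord x) u = den (coord x k).
Proof.
move=> xk1 sE; rewrite big_susp /= -mulr_sumr sE /den; congr (_ + _).
case: (posP (4 * coord x k - 3)) => -[s0 ->];
  case: (posP (- (4 * coord x k - 3))) => -[s1 ->];
  rewrite ?(gtr0_norm s0) ?(ler0_norm s0); lra.
Qed.

(** Stated for any admissible index [i], since the lift of [x] to the wedge is known only up to that
    choice; different choices matter only at the base point. *)
Lemma round_trip_start (x : realization R D) i :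
  (forall j, j <> i -> to_wedge_coord x j = cone_base j) ->
  from_wedge_coord (to_wedge_coord x i) =
  normalize total_pt (round_trip 0 (coord x)).
Proof.
have [x0 x1 _] := coordP x => xi.
have rt := round_trip_realizable x (lexx 0) ler01.
have tb := sub_realizable YD (to_base_realizable x).
have early : wt (coord x) <= 2^-1 -> normalize total_pt (to_base (coord x)) =
    normalize total_pt (round_trip 0 (coord x)).
  move=> hw; apply: eq_normalize => v; rewrite /to_base.
  rewrite (@pos_le0 _ (2 * _ - 1)) ?mul0r ?addr0; last by lra.
  case: (coneP x) => [xK xY w0 lE|k kK xk xk1 xj xL wE sE].
    rewrite round_trip_base // (cone_flow_late _ h1) ?lE // w0; lra.
  rewrite (round_trip_cone _ kK xj) mulr0 addr0 turn_time_early //; last first.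
    by rewrite wE ltW.
  rewrite wE in hw *; rewrite (@pos_le0 _ (4 * _ - 3)); last lra.
  by rewrite (@pos_le0 _ (2 * 0 - 1)) ?mulr0 ?mul0r ?addr0 //; lra.
have [hw|hw] := leP (wt (coord x)) 2^-1.
  rewrite -early //.
  have E : from_wedge_coord (to_wedge_coord x None) =
      normalize total_pt (to_base (coord x)).
    by rewrite /= normalize_normalize //; exact: to_base_realizable.
  rewrite -E; case: i xi => [k|] // xi.
  rewrite (xi None) // from_wedge_coord_base.
  have [xk|xk] := leP (coord x (val k)) 2^-1.
    by rewrite to_wedge_coord_south // from_wedge_coord_base.
  case: (coneP x) => [xK _ _ _|j jK _ _ xj _ wE _].
    by exfalso; move: xk; rewrite xK ?(valP k) //; lra.
  have [jk|jk] := eqVneq (val k) j; first by exfalso; move: xk hw; rewrite wE jk; lra.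
  by exfalso; move: xk; rewrite xj ?(valP k) //; lra.
case: (coneP x) => [_ _ w0|k kK xk xk1 xj xL wE sE]; first by exfalso; lra.
(* Above height 1/2 only the summand of [k] can be off its base point; if [i] is another index, both
   sides are the common base point. *)
have kE : from_wedge_coord (to_wedge_coord x i) =
    from_wedge_coord (to_wedge_coord x (Some (exist _ k kK))).
  have [-> //|/eqP ik] := eqVneq i (Some (exist _ k kK)).
  rewrite (xi (Some _)) ?from_wedge_coord_base; last by move=> /esym.
  case: i xi ik => [j|] xi ik; last by rewrite to_wedge_coord_base ?from_wedge_coord_base.
  rewrite to_wedge_coord_south ?from_wedge_coord_base // xj ?invr_ge0 //.
    exact: (valP j).
  by apply/eqP => jE; apply: ik; congr Some; apply: val_inj.
rewrite kE /=; set s := coord x k in xk xk1 wE sE *.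
have l0 v : 0 <= low (coord x) v by exact: low_ge0.
have d0 : 0 < den s by exact: den_gt0.
have ts := to_susp_realizable x kK.
set q := normalize _ (to_susp k (coord x)).
have fs : realizable D (from_susp k (coord q)) by exact: from_susp_realizable.
have qE u : coord q u = to_susp k (coord x) u / den s.
  by rewrite coord_normalize // to_susp_mass.
have qS : coord q (inr false) = south_weight s.
  by rewrite qE /= /south_weight -/s; congr (pos _ / _); lra.
have qN : coord q (inr true) = pos (4 * s - 3) / den s by rewrite qE.
have qL : (fun v => coord q (inl v)) = (fun v => collapse s / den s * low (coord x) v).
  by apply/funext => v; rewrite qE /= -/s mulrAC.
have cd0 : 0 <= collapse s / den s by rewrite divr_ge0 ?collapse_ge0 // ltW.
have rtE v : round_trip 0 (coord x) v =
    flow (turn_time s) (low (coord x)) v + pos (4 * s - 3) * (v == k)%:R.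
  rewrite (round_trip_cone _ kK xj) wE mulr0 addr0 mul0r addr0 subr0 mul1r.
  by rewrite (@pos_le0 _ (2 * 0 - 1)) ?mul0r ?addr0 //; lra.
rewrite wE in hw.
(* On the northern half there is no south weight and the flow time is 1, so the two vectors differ
   only by the mass [den s] divided out. *)
have [hs|hs] := leP (3 / 4) s.
  symmetry; apply: (@normalize_scale _ _ _ _ _ _ (den s)^-1) => // v.
  rewrite /from_susp qS qN qL south_weight_late // mulr0 subr0 sub0r.
  rewrite (@pos_le0 _ (-1)) ?lerN10 // mul0r addr0 cone_flow_scale //.
  rewrite rtE turn_time_late ?(ltW xk) // collapse_late //.
  by field; rewrite gt_eqF.
have pN : pos (4 * s - 3) = 0 by rewrite pos_le0 //; lra.
have [hm|hm] := leP (south_weight s) 2^-1.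
  symmetry; apply: (@normalize_scale _ _ _ _ _ _ (collapse s / den s)) => // v.
  rewrite /from_susp qS qN qL rtE pN !mul0r !addr0 cone_flow_scale //.
  rewrite (@pos_le0 _ (2 * _ - 1)) ?mul0r ?addr0; last lra.
  by rewrite /turn_time max_r //; lra.
(* Here both flows have stopped at [q0]. The factor is the ratio of the two masses there, the round
   trip carrying 1 - s. *)
symmetry; apply: (@normalize_scale _ _ _ _ _ _
  (collapse s / den s + (2 * south_weight s - 1) / (1 - s))) => // v.
rewrite /from_susp qS qN qL rtE pN !mul0r !addr0 cone_flow_scale //.
have lA : supp (low (coord x)) \in A by exact: LA xL.
have e1 : 1 - 2 * south_weight s <= 0 by lra.
have e2 : turn_time s <= 0 by rewrite /turn_time ge_max e1 andbT; lra.
rewrite (cone_flow_early _ h0 v e1) // (cone_flow_early _ h0 v e2) //.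
rewrite sE pos_ge0E; last lra.
by field; rewrite gt_eqF //=; lra.
Qed.

Lemma to_wedge_from_base (y : realization R Y) i :
  to_wedge_coord (from_wedge_coord (y : cone_summand None)) i =
  match i return cone_summand i with None => y | Some k => cone_base (Some k) end.
Proof.
have yD : realizable D (coord y) := sub_realizable YD (coord_realizable y).
have [y0 y1 yY] := coordP y.
have yK k : k \in K -> coord y k = 0 by exact: supp_out.
set x := from_wedge_coord _.
have xE : coord x = coord y.
  by apply/funext => v; rewrite /x /= coord_normalize // y1 divr1.
case: i => [k|].
  by rewrite to_wedge_coord_south // xE yK ?invr_ge0 //; exact: (valP k).
rewrite /= xE -[RHS](normalize_coord base_pt); apply: eq_normalize => v.
have w0 : wt (coord y) = 0 by rewrite /wt big1.
rewrite /to_base w0 (cone_flow_late _ h1); last lra.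
rewrite (@pos_le0 _ (2 * 0 - 1)) ?mul0r ?addr0; last lra.
by rewrite /low; case: ifP => // /yK.
Qed.

(** * The homotopy to the identity on one suspension *)

Section SuspHomotopy.
Variable k : {k : T | k \in K}.
Let Q := realization R (susp (L (val k))).

(** The homotopy moves through the base summand as well as the suspension over [k], so it is given
    by all wedge coordinates; the other suspensions rest at their south poles. *)
Definition susp_coord (z : unit_interval R * Q) i : cone_summand i :=
  match i return cone_summand i with
  | None => normalize base_pt (susp_base (time z.1) (coord z.2))
  | Some j => normalize (south_pt j)
      (if j == k then susp_susp (time z.1) (coord z.2)
       else susp_vec 0 (fun=> 0) (-1))
  end.

(** Its sign decides which coordinate may be off its base point. By time 1/4 it is at most 0
    everywhere. *)
Definition flow_time (z : unit_interval R * Q) : R :=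
  Num.min (1 - 2 * coord z.2 (inr false)) (1 - 2 * coord z.2 (inr true))
  - 4 * time z.1.

Lemma susp_coord_base z : flow_time z <= 0 -> susp_coord z None = cone_base None.
Proof.
case: z => t q; rewrite /flow_time /= => hz.
have /andP[t0 t1] := time_itv t.
have [y0 [n0 m0] nm s1 yL] := susp_coordP q.
apply: (@normalize_base_pt _ _ (\sum_v coord q (inl v) +
  (pos (2 * coord q (inr false) - 1) + pos (2 * coord q (inr true) - 1)))).
  exact: (sub_realizable AY (susp_base_realizable q (valP k) t0)).
move=> v; rewrite /susp_base (cone_flow_early _ h0) //; first by rewrite -mulrDl.
exact: LA (valP k) yL.
Qed.

(** A positive flow time forces t < 1/4 and north weight below 1/2; then the base factor is 0 and
    the height negative. *)
Lemma susp_coord_south z j : 0 < flow_time z \/ j <> k ->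
  susp_coord z (Some j) = cone_base (Some j).
Proof.
case: z => t q; rewrite /flow_time /= => hz.
have /andP[t0 t1] := time_itv t.
have [y0 [n0 m0] nm s1 yL] := susp_coordP q.
case: eqP => jk; last first.
  by apply: normalize_south => [|v]; rewrite ?ltrN10 ?mul0r.
case: hz => // hz.
have hmin : 4 * time t < 1 - 2 * coord q (inr true).
  by rewrite -subr_gt0 (lt_le_trans hz) // lerD2r ge_min lexx orbT.
rewrite /susp_susp (@pos_le0 _ (4 * _ - 1)); last lra.
apply: normalize_south => [|v]; first by rewrite mul0r addr0; nra.
by rewrite collapse_early ?mulr0 ?addr0 ?mul0r //; lra.
Qed.

Lemma susp_coord_sparse z : exists i, forall j, j <> i -> susp_coord z j = cone_base j.
Proof.
have [hz|hz] := ltP 0 (flow_time z).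
  by exists None; case=> // j _; apply: susp_coord_south; left.
exists (Some k) => -[j jk|_]; last exact: susp_coord_base.
by apply: susp_coord_south; right => jE; apply: jk; rewrite jE.
Qed.

Lemma susp_coord_continuous i : continuous (fun z => susp_coord z i).
Proof.
have ct : continuous (fun z : unit_interval R * Q => time z.1).
  by move=> z; apply: continuous_comp; [exact: cvg_fst|exact: continuous_time].
have cq u : continuous (fun z : unit_interval R * Q => coord z.2 u).
  by apply: continuous_comp_coord => z; exact: cvg_snd.
case: i => [j|] /=.
  have [jk|jk] := eqVneq j k; apply: normalize_continuous.
  - rewrite jk => -[t q] /=; have /andP[? ?] := time_itv t.
    by apply: susp_susp_realizable => //; exact: (valP k).
  - have c1t : continuous (fun z : unit_interval R * Q => 1 - time z.1).
      by apply: continuous_sub => //; exact: continuous_const.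
    have cpt : continuous (fun z : unit_interval R * Q => pos (4 * time z.1 - 1)).
      by apply: continuous_pos; exact: continuous_affine.
    move=> u; apply: continuous_susp_vec => [||v]; last exact: cq.
      apply: continuous_add => //; apply: continuous_mul => //.
      by apply: continuous_collapse; exact: cq.
    apply: continuous_add; apply: continuous_mul => //.
      by apply: continuous_affine; exact: cq.
    by apply: continuous_sub; exact: cq.
  - by move=> z; apply: south_realizable; exact: L0 (valP j).
  - by move=> u; exact: continuous_const.
apply: normalize_continuous.
  move=> [t q] /=; have /andP[? ?] := time_itv t.
  exact: (sub_realizable AY (susp_base_realizable q (valP k) _)).
move=> v; apply: continuous_add.
  apply: (cone_flow_continuous dA ch h1).
  - apply: continuous_sub.
      by apply: continuous_minr; apply: continuous_coaffine; exact: cq.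
    by apply: continuous_mul => //; exact: continuous_const.
  - by move=> u; exact: cq.
  - by move=> [t q] u; have [] := susp_coordP q.
  - by move=> [t q]; left; have [_ _ _ _] := susp_coordP q; apply: LA; exact: valP.
apply: continuous_mul; last exact: continuous_const.
by apply: continuous_add; apply: continuous_pos; apply: continuous_affine; exact: cq.
Qed.

Lemma susp_coord_start (t : unit_interval R) (q : Q) i : time t = 0 ->
  susp_coord (t, q) i = to_wedge_coord (from_wedge_coord (q : cone_summand (Some k))) i.
Proof.
move=> t0; have [y0 [n0 m0] nm s1 yL] := susp_coordP q.
have kK := valP k; have yA := LA kK yL.
have yK j : j \in K -> coord q (inl j) = 0.
  by move=> jK; apply: (@supp_out (fun v => coord q (inl v))) => //; exact: AY.
have flowK a j : j \in K -> flow a (fun v => coord q (inl v)) j = 0.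
  by move=> jK; apply: (@supp_out (flow a _)) => //; apply: AY; exact: cone_flow_supp.
have q0K j : j \in K -> coord q0 j = 0.
  by move=> jK; apply: supp_out => //; apply: AY; have [] := coordP q0.
have fs := from_susp_realizable q kK.
have sb := susp_base_realizable q kK (lexx 0).
set p := from_wedge_coord _.
have pE v : coord p v = from_susp (val k) (coord q) v
    / \sum_u from_susp (val k) (coord q) u by rewrite coord_normalize.
(* On the southern half the image has no apex weight, so it lies in the base and all suspension
   coordinates are south poles. *)
case: nm => [n_eq0|m_eq0].
  have fE : from_susp (val k) (coord q) =1 susp_base 0 (coord q).
    move=> v; rewrite /from_susp /susp_base n_eq0 mul0r addr0 !mulr0 !subr0 min_l; last lra.
    by rewrite (@pos_le0 _ (0 - 1)) ?addr0 //; lra.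
  have pK j : j \in K -> coord p j = 0.
    by move=> jK; rewrite pE fE /susp_base flowK // q0K // mulr0 addr0 mul0r.
  case: i => [j|]; last first.
    rewrite /= t0; apply: (@normalize_scale _ _ _ _ _ _
      (\sum_u from_susp (val k) (coord q) u)^-1).
    - exact: (sub_realizable AY sb).
    - exact: to_base_realizable.
    move=> v; have w0 : wt (coord p) = 0 by rewrite /wt big1.
    rewrite /to_base w0 (cone_flow_late _ h1); last lra.
    rewrite (@pos_le0 _ (2 * 0 - 1)) ?mul0r ?addr0; last lra.
    rewrite -fE mulrC -pE /low.
    by case: ifP => // /pK.
  rewrite [RHS]to_wedge_coord_south; last by rewrite pK ?invr_ge0 //; exact: (valP j).
  rewrite /= t0; case: eqP => _; last first.
    by apply: normalize_south => [|v]; rewrite ?ltrN10 ?mul0r.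
  rewrite /susp_susp n_eq0 (@pos_le0 _ (4 * 0 - 1)); last lra.
  apply: normalize_south => [|v]; first lra.
  by rewrite collapse_early ?invr_ge0 // mulr0 addr0 mul0r.
(* On the northern half the flow time is 1 and the mass stays 1: the image is the cone point with
   the coordinates of [q], and the formulas match without rescaling. *)
have fE v : from_susp (val k) (coord q) v =
    coord q (inl v) + coord q (inr true) * (v == val k)%:R.
  rewrite /from_susp m_eq0 (cone_flow_late _ h1); last lra.
  by rewrite (@pos_le0 _ (2 * 0 - 1)) ?mul0r ?addr0 //; lra.
have fS : \sum_u from_susp (val k) (coord q) u = 1.
  under eq_bigr do rewrite fE.
  rewrite big_split /= -mulr_sumr s1 (bigD1 (val k)) //= eqxx big1.
    by rewrite m_eq0 addr0 mulr1; lra.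
  by move=> v /negbTE ->.
have {fS}pE v : coord p v = coord q (inl v) + coord q (inr true) * (v == val k)%:R.
  by rewrite pE fS divr1 fE.
have pk : coord p (val k) = coord q (inr true) by rewrite pE eqxx mulr1 yK ?add0r.
have pj j : j \in K -> j != val k -> coord p j = 0.
  by move=> jK /negbTE jk; rewrite pE jk mulr0 addr0 yK.
have lE : low (coord p) = (fun v => coord q (inl v)).
  apply/funext => v; rewrite /low; case: ifP => [/yK -> //|vK].
  rewrite pE; case: eqP => [vE|_]; last by rewrite mulr0 addr0.
  by rewrite vE kK in vK.
have wE : wt (coord p) = coord q (inr true).
  by rewrite /wt (bigD1 (val k)) //= pk big1 ?addr0 // => j /andP[]; exact: pj.
case: i => [j|].
  have [jk|/eqP jk] := eqVneq j k.
    rewrite /= jk eqxx t0; apply: eq_normalize => u.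
    rewrite /to_susp lE pk /susp_susp (@pos_le0 _ (4 * 0 - 1)); last lra.
    by rewrite !mul0r !addr0 subr0 !mul1r.
  rewrite susp_coord_south; last by right.
  rewrite to_wedge_coord_south // pj ?invr_ge0 //; first exact: (valP j).
  by apply/eqP => /val_inj.
rewrite /= t0; apply: eq_normalize => v.
rewrite /to_base /susp_base lE wE m_eq0 !mulr0 !subr0 min_r; last lra.
by rewrite (@pos_le0 _ (0 - 1)) ?add0r //; lra.
Qed.

Lemma susp_coord_end (t : unit_interval R) (q : Q) i : time t = 1 ->
  susp_coord (t, q) i = wedge_prod (wedge_lift cone_base (q : cone_summand (Some k))) i.
Proof.
move=> t1; have [y0 [n0 m0] nm s1 yL] := susp_coordP q.
have hz : flow_time (t, q) <= 0.
  by rewrite /flow_time /= t1 lerBlDr ge_min; apply/orP; left; lra.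
rewrite wedge_prod_lift; have [->|ik] := eqVneq i (Some k); last first.
  rewrite dfwithout 1?eq_sym //.
  case: i ik => [j|] ik; last exact: susp_coord_base.
  by apply: susp_coord_south; right => jE; rewrite jE eqxx in ik.
rewrite dfwithin /= eqxx t1 -[RHS](normalize_coord (south_pt k)); apply/esym.
(* At time 1 the base factor and the height factor are both 4 * 1 - 1. *)
apply: (@normalize_scale _ _ _ _ _ _ 3).
- exact: coord_realizable.
- by apply: susp_susp_realizable; rewrite ?ler01 //; exact: (valP k).
rewrite /susp_susp subrr !mul0r !add0r pos_ge0E; last lra.
have -> : 4 * 1 - 1 = 3 :> R by lra.
set n := coord q (inr true) in n0 nm s1 *; set m := coord q (inr false) in m0 nm s1 *.
case=> [v|[]] //=.
  by case: (posP (3 * (n - m))) => -[? ->]; case: nm => ?; rewrite -/n; lra.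
by case: (posP (- (3 * (n - m)))) => -[? ->]; case: nm => ?; rewrite -/m; lra.
Qed.

Lemma susp_coord_at_base (t : unit_interval R) i : susp_coord (t, south_pt k) i = cone_base i.
Proof.
have /andP[t0 t1] := time_itv t.
case: i => [j|].
  have [jk|/eqP jk] := eqVneq j k; last by apply: susp_coord_south; right.
  rewrite /= jk eqxx; apply: normalize_south => [|v]; rewrite !coord_south ?mulr0 //=.
  by case: (posP (4 * time t - 1)) => -[? ->]; lra.
apply: susp_coord_base; rewrite /flow_time /= !coord_south /= lerBlDr ge_min.
by apply/orP; left; lra.
Qed.

End SuspHomotopy.

Lemma cone_wedge : homotopy_equivalent R (realization R D) (wedge cone_base).
Proof.
have finI : finite_set [set: option {k : T | k \in K}] by exact: finite_finset.
have cb := cone_base_closed.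
have [f cf fE] := wedge_map finI cb to_wedge_coord_sparse to_wedge_coord_continuous.
have gE i j : from_wedge_coord (cone_base i) = from_wedge_coord (cone_base j).
  by rewrite !from_wedge_coord_base.
pose g : wedge cone_base -> realization R D := wedge_fun from_wedge_coord.
have fL (x : realization R D) i : (forall j, j <> i -> to_wedge_coord x j = cone_base j) ->
    f x = wedge_lift cone_base (to_wedge_coord x i).
  by move=> xi; apply: wedge_prod_inj; rewrite fE wedge_prod_sparse.
exists f, g; split=> //; split; last split.
- by apply: wedge_fun_continuous => //; exact: from_wedge_coord_continuous.
- exists (fun z => normalize total_pt (round_trip (time z.1) (coord z.2))).
  split; last split=> t x tE.
  + have ct : continuous (fun z : unit_interval R * realization R D => time z.1).
      by move=> z; apply: continuous_comp; [exact: cvg_fst|exact: continuous_time].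
    have cx v : continuous (fun z : unit_interval R * realization R D => coord z.2 v).
      by apply: continuous_comp_coord => z; exact: cvg_snd.
    have w1 (z : unit_interval R * realization R D) : wt (coord z.2) <= 1.
      by case: (coneP z.2) => [_ _ -> //|k _ _ ? _ _ -> //].
    apply: normalize_continuous => [[t x]|v] /=.
      by have /andP[? ?] := time_itv t; exact: round_trip_realizable.
    have cw := continuous_wt cx.
    apply: continuous_add.
      apply: (cone_flow_continuous dA ch h1).
      * apply: continuous_add.
          apply: continuous_maxr; apply: continuous_coaffine => //.
          exact: continuous_south_weight.
        by apply: continuous_mul => //; exact: continuous_const.
      * exact: continuous_low.
      * by move=> [t x] u; apply: low_ge0; have [] := coordP x.
      * move=> [t x] /=; have /andP[? ?] := time_itv t.
        case: (coneP x) => [_ _ -> _|k kK _ _ _ xL _ _].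
          by right; rewrite turn_time_early //; lra.
        by left; exact: LA xL.
    case: (v \in K); last exact: continuous_const.
    apply: continuous_add; apply: continuous_mul => //.
    * by apply: continuous_sub => //; exact: continuous_const.
    * by apply: continuous_pos; exact: continuous_affine.
    * by apply: continuous_pos; exact: continuous_affine.
  + have {}tE : time t = 0 by [].
    have [i xi] := to_wedge_coord_sparse x.
    by rewrite /= (fL _ _ xi) /g wedge_lift_funE // round_trip_start // tE.
  + have {}tE : time t = 1 by [].
    rewrite /= tE -[RHS](normalize_coord total_pt); apply: eq_normalize => v.
    case: (coneP x) => [xK _ _ _|k kK xk xk1 xj xL wE sE].
      by rewrite round_trip_base.
    have [x0 _ _] := coordP x.
    rewrite /round_trip (cone_flow_late _ h1); last first.
      by have : -1 <= turn_time (wt (coord x)) by [apply: turn_time_geN1; rewrite wE]; lra.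
    rewrite subrr mul0r add0r (_ : pos _ = 1); last by rewrite pos_ge0E; lra.
    by rewrite mul1r /low; case: ifP => _; rewrite ?add0r ?addr0.
(* The base summand stays still, because the composite is exactly the identity on it; this matches
   the suspensions, whose south poles stay at the base point. *)
pose H i : unit_interval R * cone_summand i -> wedge cone_base :=
  match i return unit_interval R * cone_summand i -> wedge cone_base with
  | None => fun z => wedge_lift cone_base (z.2 : cone_summand None)
  | Some k => s2val (wedge_map finI cb (@susp_coord_sparse k) (@susp_coord_continuous k))
  end.
have HE (k : {k : T | k \in K}) z : wedge_prod (H (Some k) z) = susp_coord z.
  by rewrite /H; case: (wedge_map _ _ _ _) => /= F _; exact.
apply: (wedge_homotopic (R := R) finI cb (H := H)).
- case=> [k|].
    by rewrite /H; case: (wedge_map _ _ _ _).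
  move=> z; apply: (@continuous_comp _ _ _ snd (@wedge_lift _ _ cone_base None)).
    exact: cvg_snd.
  exact: wedge_lift_continuous.
- have HB (t : unit_interval R) i : H i (t, cone_base i) = wedge_lift cone_base (cone_base None).
    case: i => [k|] //; apply: wedge_prod_inj; rewrite HE wedge_prod_sparse //.
    by apply: functional_extensionality_dep => i; exact: susp_coord_at_base.
  by move=> t i j; rewrite !HB.
- move=> t i x tE; rewrite /= /g wedge_lift_funE //; apply: wedge_prod_inj.
  rewrite fE; apply: functional_extensionality_dep => j.
  case: i x => [k|] x; first by rewrite HE; exact: susp_coord_start.
  rewrite to_wedge_from_base wedge_prod_lift.
  case: j => [j|]; first by rewrite dfwithout.
  by rewrite dfwithin.
- move=> t i x tE; apply: wedge_prod_inj.
  case: i x => [k|] // x; rewrite HE; apply: functional_extensionality_dep => j.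
  exact: susp_coord_end.
Qed.

End ConesOverContractible.

(** * Contracting a wedge of suspensions *)

Section SuspensionContraction.
Variables (R : realType) (V : finType) (B : {set {set V}}).
Hypothesis dB : down_closed B.
Hypothesis B0 : finset.set0 \in B.

(** Read from t = 1 down to 0: until 1/2 the base contracts to [q0], leaving an arc from pole to
    pole; then the arc slides down to the south pole. Fixing that pole makes the contraction extend
    over a wedge. *)
Lemma susp_contraction : contractible R (realization R B) ->
  exists H : unit_interval R * realization R (susp B) -> realization R (susp B),
    [/\ continuous H,
        forall t q, time t = 0 -> H (t, q) = south R B0,
        forall t q, time t = 1 -> H (t, q) = q &
        forall t, H (t, south R B0) = south R B0].
Proof.
move=> [q0 [h [ch [h0 h1]]]].
pose c (t : R) := Num.min 1 (2 * t).
(* The term at [q0] supplies mass to points sliding down from the north as they cross height 0; the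
   image of the north pole would otherwise vanish there. *)
pose y (t : R) (q : V + bool -> R) (v : V) : R := cone_flow q0 h (2 * t - 1) (fun v => q (inl v)) v
  + (1 - c t) * q (inr true) * coord q0 v.
pose w (t : R) (q : V + bool -> R) : R := c t * (q (inr true) - q (inr false)) - (1 - c t).
have cP (t : R) : 0 <= t -> t <= 1 ->
    [/\ 0 <= c t, c t <= 1 & 1 - c t = 0 \/ 2 * t - 1 <= 0].
  move=> t0 t1; rewrite /c; case: (leP 1 (2 * t)) => ht; split;
    by [lra|left; lra|right; lra].
have yr (t : R) (q : realization R (susp B)) : 0 <= t -> t <= 1 ->
    realizable (susp B) (susp_vec (c t) (y t (coord q)) (w t (coord q))).
  move=> t0 t1; have [y0 [n0 m0] nm s1 yB] := susp_coordP q.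
  have [c0 c1 ct] := cP t t0 t1; have [p0 p1 _] := coordP q0.
  have c1' : 0 <= 1 - c t by lra.
  apply: susp_vec_realizable => //.
  - by move=> v; rewrite /y addr_ge0 ?cone_flow_ge0 ?mulr_ge0.
  - right; have := @cone_flow_supp_shift _ _ _ q0 q0 h dB h0 (2 * t - 1)
      (fun v => coord q (inl v)) ((1 - c t) * coord q (inr true)) y0 yB; apply.
    by case: ct => [->|]; [left; rewrite mul0r|right].
  rewrite /y big_split /= cone_flow_mass -mulr_sumr p1 mulr1 s1 /w.
  set n := coord q (inr true) in n0 nm s1 *; set m := coord q (inr false) in m0 nm s1 *.
  have s0 : 0 <= 1 - n - m by rewrite -s1 sumr_ge0.
  have [wE|wN] := eqVneq (c t * (n - m) - (1 - c t)) 0; last first.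
    apply: ltr_wpDl; last by rewrite normr_gt0.
    by rewrite mulr_ge0 // addr_ge0 ?mulr_ge0.
  rewrite wE normr0 addr0; case: nm => E; rewrite E in wE s0 *.
    have c_eq1 : c t = 1 by have := mulr_ge0 c0 m0; lra.
    by rewrite c_eq1 in wE *; lra.
  have cN0 : 0 < c t.
    by rewrite lt_neqAle c0 andbT eq_sym; apply/eqP => cE; rewrite cE in wE; lra.
  rewrite (_ : 1 - n - 0 + (1 - c t) * n = c t); first by rewrite mulr_gt0.
  by lra.
pose H (z : unit_interval R * realization R (susp B)) := normalize (south R B0)
  (susp_vec (c (time z.1)) (y (time z.1) (coord z.2)) (w (time z.1) (coord z.2)))
  : realization R (susp B).
exists H; split.
- have ct : continuous (fun z : unit_interval R * realization R (susp B) => time z.1).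
    by move=> z; apply: continuous_comp; [exact: cvg_fst|exact: continuous_time].
  have cc : continuous (fun z : unit_interval R * realization R (susp B) => c (time z.1)).
    apply: continuous_minr; first exact: continuous_const.
    by apply: continuous_mul => //; exact: continuous_const.
  have cc' : continuous (fun z : unit_interval R * realization R (susp B) =>
      1 - c (time z.1)).
    by apply: continuous_sub => //; exact: continuous_const.
  have cq u : continuous (fun z : unit_interval R * realization R (susp B) => coord z.2 u).
    by apply: continuous_comp_coord => z; exact: cvg_snd.
  apply: normalize_continuous => [[t q]|u] /=.
    by have /andP[? ?] := time_itv t; exact: yr.
  apply: continuous_susp_vec => //.
    apply: continuous_sub => //; apply: continuous_mul => //.
    exact: continuous_sub.
  move=> v; apply: continuous_add; last first.
    by apply: continuous_mul; [exact: continuous_mul|exact: continuous_const].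
  apply: (cone_flow_continuous dB ch h1) => //.
  + exact: continuous_affine.
  + by move=> [t q] v'; have [] := susp_coordP q.
  + by move=> [t q]; left; have [] := susp_coordP q.
- move=> t q t0; rewrite /H /= t0.
  have cE : c 0 = 0 by rewrite /c mulr0 min_r.
  by apply: normalize_south => [|v]; rewrite ?/w cE ?mul0r // sub0r subr0 ltrN10.
- move=> t q t1; rewrite /H /= t1.
  have cE : c 1 = 1 by rewrite /c mulr1 min_l //; lra.
  have [y0 [n0 m0] nm _ _] := susp_coordP q.
  rewrite -[RHS](normalize_coord (south R B0)); apply: eq_normalize => -[v|[]] /=.
  + by rewrite cE /y cE subrr !mul0r addr0 mul1r (cone_flow_late _ h1) //; lra.
  + rewrite /w cE; set d := _ - (1 - 1).
    by case: (posP d) => -[]; rewrite /d => ? ->; case: nm => ?; lra.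
  + rewrite /w cE; set d := _ - (1 - 1).
    by case: (posP (- d)) => -[]; rewrite /d => ? ->; case: nm => ?; lra.
- move=> t; have /andP[t0 t1] := time_itv t; have [c0 c1 ct] := cP _ t0 t1.
  apply: normalize_south => [|v]; first by rewrite /w !coord_south /=; lra.
  rewrite /y [coord _ (inr true)]coord_south /= mulr0 mul0r addr0.
  suff -> : cone_flow q0 h (2 * time t - 1) (fun v => coord (south R B0) (inl v)) v = 0.
    by rewrite mulr0.
  (* The south pole has zero base part, written as a multiple by 0 so that homogeneity of the flow
     applies. *)
  rewrite (_ : (fun v => _) = (fun v => 0 * (0 : R))); last first.
    by apply/funext => u; rewrite coord_south mul0r.
  by rewrite cone_flow_scale ?mul0r.
Qed.

End SuspensionContraction.

(** Two stages are concatenated, through the retraction [r] of the wedge onto its summand [None]. *)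
Lemma wedge_contractible (R : realType) (J : choiceType)
    (X : option J -> topologicalType) (p0 : forall i, X i) :
  finite_set [set: option J] -> (forall i, closed [set p0 i]) ->
  contractible R (X None) ->
  (forall j, exists H : unit_interval R * X (Some j) -> X (Some j),
    [/\ continuous H,
        forall t x, time t = 0 -> H (t, x) = p0 (Some j),
        forall t x, time t = 1 -> H (t, x) = x &
        forall t, H (t, p0 (Some j)) = p0 (Some j)]) ->
  contractible R (wedge p0).
Proof.
move=> finJ cp0 [x0 [h [ch [h0 h1]]]] hX.
pose H j := projT1 (cid (hX j)).
have [cH H0 H1 Hb] : [/\ forall j, continuous (H j),
    forall j t x, time t = 0 -> H j (t, x) = p0 (Some j),
    forall j t x, time t = 1 -> H j (t, x) = x &
    forall j t, H j (t, p0 (Some j)) = p0 (Some j)].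
  by split=> j; rewrite /H; case: (cid (hX j)) => F [].
have baseE i : wedge_lift p0 (p0 i) = wedge_lift p0 (p0 None).
  exact: (wedge_liftE p0 (p0 None) (p0 i)).
pose r i : X i -> wedge p0 := match i return X i -> wedge p0 with
  | None => fun x => wedge_lift p0 x
  | Some _ => fun=> wedge_lift p0 (p0 None) end.
have rE i j : r i (p0 i) = r j (p0 j) by case: i j => [?|] [?|].
exists (wedge_lift p0 x0); apply: (@homotopic_trans _ _ _ _ (wedge_fun r)).
  (* The contraction of the summand [None] may move the base point, so the collapsed summands follow
     its path. *)
  pose G i : unit_interval R * X i -> wedge p0 :=
    match i return unit_interval R * X i -> wedge p0 with
    | None => fun z => wedge_lift p0 (h z)
    | Some _ => fun z => wedge_lift p0 (h (z.1, p0 None)) end.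
  apply: (wedge_homotopic (R := R) finJ cp0 (H := G)).
  - case=> [j|] z.
      apply: (@continuous_comp _ _ _ _ (@wedge_lift _ _ p0 None)); last first.
        exact: wedge_lift_continuous.
      apply: (@continuous_comp _ _ _ (fun z => (z.1, p0 None)) h); last exact: ch.
      by apply: cvg_pair_at; [exact: cvg_fst|exact: cvg_cst].
    apply: (@continuous_comp _ _ _ _ (@wedge_lift _ _ p0 None)); first exact: ch.
    exact: wedge_lift_continuous.
  - by move=> t [?|] [?|].
  - by move=> t [j|] x t0 /=; rewrite h0.
  - by move=> t [j|] x t1; rewrite wedge_lift_funE //= h1.
pose G i : unit_interval R * X i -> wedge p0 :=
  match i return unit_interval R * X i -> wedge p0 with
  | None => fun z => wedge_lift p0 z.2
  | Some j => fun z => wedge_lift p0 (H j z) end.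
apply: (wedge_homotopic (R := R) finJ cp0 (H := G)).
- case=> [j|] z.
    apply: (@continuous_comp _ _ _ _ (@wedge_lift _ _ p0 (Some j))); first exact: cH.
    exact: wedge_lift_continuous.
  apply: (@continuous_comp _ _ _ snd (@wedge_lift _ _ p0 None)); first exact: cvg_snd.
  exact: wedge_lift_continuous.
- have GE t i : G i (t, p0 i) = wedge_lift p0 (p0 None).
    by case: i => [j|] //=; rewrite Hb baseE.
  by move=> t i j; rewrite !GE.
- by move=> t [j|] x t0; rewrite wedge_lift_funE //= H0 // baseE.
- by move=> t [j|] x t1 //=; rewrite H1.
Qed.

(** * Independence complexes *)

Local Close Scope classical_set_scope.
Local Close Scope ring_scope.

Section Independence.
Variables (T : finType) (e : rel T).
Implicit Types (s t W : {set T}).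

Lemma IndP W s : reflect (s \subset W /\ forall x y, x \in s -> y \in s -> ~~ e x y)
  (s \in Ind e W).
Proof.
rewrite inE; apply: (iffP andP) => -[sW /= es]; split=> //.
  by move=> x y xs ys; move/forall_inP: es => /(_ x xs) /forall_inP /(_ y ys).
by apply/forall_inP => x xs; apply/forall_inP => y ys; exact: es.
Qed.

Lemma Ind_down_closed W : down_closed (Ind e W).
Proof.
move=> s t /IndP[sW es] ts; apply/IndP; split; first exact: fintype.subset_trans ts sW.
by move=> x y /(fintype.subsetP ts) xs /(fintype.subsetP ts); exact: es.
Qed.

Lemma Ind0 W : finset.set0 \in Ind e W.
Proof. by apply/IndP; split=> [|x y]; rewrite ?finset.sub0set ?inE. Qed.

(** A removed face is maximal, hence lies in no remaining face. *)
Lemma down_closed_setD (D Gs : {set {set T}}) : down_closed D ->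
  (forall s, s \in Gs -> maximal_face D s) -> down_closed (D :\: Gs).
Proof.
move=> dD mG s t; rewrite !finset.in_setD => /andP[sG sD] ts.
rewrite (dD _ _ sD ts) andbT; apply/negP => tG.
by have [_ /(_ s sD ts) st] := mG t tG; rewrite st tG in sG.
Qed.

Variable K : {set T}.
Hypothesis ge : simple_graph e.
Hypothesis cK : forall k1 k2, k1 \in K -> k2 \in K -> k1 != k2 -> e k1 k2.

Local Notation link k := (Ind e (~: (K :|: nbhd e k))).

Lemma link_base k s : s \in link k -> s \in Ind e (~: K).
Proof.
move=> /IndP[sW es]; apply/IndP; split=> //; apply: fintype.subset_trans sW _.
by rewrite finset.setCS finset.subsetUl.
Qed.

(** An independent set meets the clique [K] in at most one vertex, so deleting [k] leaves [K]
    altogether. *)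
Lemma Ind_linkD1 k s : k \in K -> k \in s -> s \in Ind e [set: T]%SET ->
  s :\ k \in link k.
Proof.
move=> kK ks sI; have /IndP[_ es] := sI; apply/IndP; split.
  apply/fintype.subsetP => v; rewrite !inE => /andP[vk vs].
  rewrite negb_or es // andbT; apply/negP => vK.
  by have := es k v ks vs; rewrite cK // eq_sym.
by move=> x y /finset.setD1P[_ xs] /finset.setD1P[_ ys]; exact: es.
Qed.

Lemma Ind_linkU1 k t : k \in K -> t \in link k -> k |: t \in Ind e [set: T]%SET.
Proof.
move=> kK /IndP[tW et]; have [sym irr] := ge; apply/IndP; split; first exact: finset.subsetT.
have kt v : v \in t -> ~~ e k v.
  by move/(fintype.subsetP tW); rewrite !inE negb_or => /andP[].
move=> x y /finset.setU1P[->|xt] /finset.setU1P[->|yt]; first by rewrite irr.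
- exact: kt.
- by rewrite sym kt.
- exact: et.
Qed.

Lemma Ind_split s : s \in Ind e [set: T]%SET <->
  s \in Ind e (~: K) \/ exists k t, [/\ k \in K, t \in link k & s = k |: t].
Proof.
split=> [sI|[/IndP[_ es]|[k [t [kK tL ->]]]]]; last exact: Ind_linkU1.
  have [sK|/subsetPn[k ks]] := boolP (s \subset ~: K).
    by left; have /IndP[_ es] := sI; apply/IndP.
  rewrite inE negbK => kK; right; exists k, (s :\ k); split=> //.
    exact: Ind_linkD1.
  by rewrite finset.setD1K.
by apply/IndP; split; first exact: finset.subsetT.
Qed.

Lemma base_notin s v : s \in Ind e (~: K) -> v \in s -> v \notin K.
Proof. by move=> /IndP[/fintype.subsetP sK _] /sK; rewrite inE. Qed.

Lemma link_notin k s v : s \in link k -> v \in s -> v \notin K.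
Proof. by move=> /link_base; exact: base_notin. Qed.

Variable Gs : {set {set T}}.
Hypothesis mG : forall s, s \in Gs -> maximal_face (Ind e (~: K)) s.
Hypothesis aG : forall k s, k \in K -> s \in Gs -> exists2 v, v \in s & e k v.

Lemma link_notin_generating k s : k \in K -> s \in link k ->
  s \in Ind e (~: K) :\: Gs.
Proof.
move=> kK sL; rewrite finset.in_setD (link_base sL) andbT; apply/negP => /(aG kK)[v vs kv].
have /IndP[/fintype.subsetP /(_ v vs)] := sL.
by rewrite !inE kv orbT.
Qed.

Variable Gk : T -> {set {set T}}.
Hypothesis mGk : forall k s, k \in Kprime e K -> s \in Gk k -> maximal_face (link k) s.

Definition cone_generators : {set {set T}} :=
  Gs :|: [set [set k] | k in K :\: Kprime e K]
     :|: \bigcup_(k in Kprime e K) [set k |: s | s in Gk k].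

Lemma in_Kprime k : (k \in Kprime e K) =
  (k \in K) && (~: (K :|: nbhd e k) != finset.set0).
Proof. by rewrite inE. Qed.

Lemma cone_generatorsP s : reflect
  [\/ s \in Gs, exists k, [/\ k \in K, k \notin Kprime e K & s = [set k]] |
      exists k t, [/\ k \in Kprime e K, t \in Gk k & s = k |: t]]
  (s \in cone_generators).
Proof.
rewrite /cone_generators !finset.in_setU; apply: (iffP idP) =>
  [/orP[/orP[]|]|[sG|[k [kK kK' sE]]|[k [t [kK tG sE]]]]].
- by move=> sG; constructor 1.
- by case/imsetP => k /finset.setDP[kK kK'] sE; constructor 2; exists k.
- by case/finset.bigcupP => k kK /imsetP[t tG sE]; constructor 3; exists k, t.
- by rewrite sG.
- by apply/orP; left; apply/orP; right; apply/imsetP; exists k => //; apply/finset.setDP.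
- by apply/orP; right; apply/finset.bigcupP; exists k => //; apply/imsetP; exists t.
Qed.

Lemma link_trivial k t : k \in K -> k \notin Kprime e K -> t \in link k ->
  t = finset.set0.
Proof.
move=> kK; rewrite in_Kprime kK negbK /= => /eqP kE /IndP[+ _].
by rewrite kE finset.subset0 => /eqP.
Qed.

(** A face of [Gs] cannot be enlarged by a vertex of [K], being adjacent to each; for the other two
    kinds, deleting [k] reduces maximality to the link. *)
Lemma cone_generators_maximal s : s \in cone_generators ->
  maximal_face (Ind e [set: T]%SET) s.
Proof.
case/cone_generatorsP => [sG|[k [kK kK' ->]]|[k [t [kK' tG ->]]]].
- have [sI sM] := mG sG; split; first by apply/Ind_split; left.
  move=> t tI st; case/Ind_split: (tI) => [tK|[k [t' [kK _ tE]]]]; first exact: sM.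
  have [v vs kv] := aG kK sG.
  have kt : k \in t by rewrite tE finset.setU11.
  by have /IndP[_ /(_ k v kt (fintype.subsetP st v vs))] := tI; rewrite kv.
- split; first by rewrite -(finset.setU0 [set k]); apply: Ind_linkU1 => //; exact: Ind0.
  move=> t tI kt; have kint : k \in t by apply: (fintype.subsetP kt); rewrite finset.set11.
  by rewrite -(finset.setD1K kint) (link_trivial kK kK' (Ind_linkD1 kK kint tI)) finset.setU0.
- have kK : k \in K by move: kK'; rewrite in_Kprime => /andP[].
  have [tL tM] := mGk kK' tG; split; first exact: Ind_linkU1.
  move=> s' sI st; have ks : k \in s' by apply: (fintype.subsetP st); rewrite finset.setU11.
  rewrite -(finset.setD1K ks); congr (_ |: _); apply: tM; first exact: Ind_linkD1.
  apply/fintype.subsetP => v vt; rewrite !inE (fintype.subsetP st) ?andbT ?inE ?vt ?orbT //.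
  by apply: contraTneq (link_notin tL vt) => ->; rewrite kK.
Qed.

(** Link faces avoid [K], so a face k |: t determines both [k] and [t], and whether it is removed
    can be read off [t]. *)
Lemma generating_split s : s \in Ind e [set: T]%SET :\: cone_generators <->
  s \in Ind e (~: K) :\: Gs \/
  exists k t, [/\ k \in Kprime e K, t \in link k :\: Gk k & s = k |: t].
Proof.
have K'K k : k \in Kprime e K -> k \in K by rewrite in_Kprime => /andP[].
rewrite !finset.in_setD; split.
  move=> /andP[/cone_generatorsP sG /Ind_split[sK|[k [t [kK tL sE]]]]].
    by left; rewrite sK andbT; apply/negP => ?; apply: sG; constructor 1.
  right; exists k, t; have [kK'|kK'] := boolP (k \in Kprime e K); last first.
    case: sG; constructor 2; exists k; split=> //.
    by rewrite sE (link_trivial kK kK' tL) finset.setU0.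
  split=> //; rewrite finset.in_setD tL andbT; apply/negP => tG.
  by apply: sG; constructor 3; exists k, t.
move=> [/andP[sG sK]|[k [t [kK' /finset.setDP[tL tG] sE]]]].
  apply/andP; split; last by apply/Ind_split; left.
  apply/cone_generatorsP => -[|[k [kK _ sE]]|[k [t [kK' _ sE]]]].
  - by rewrite (negbTE sG).
  - by have := @base_notin s k sK; rewrite sE finset.set11 kK => /(_ isT).
  - by have := @base_notin s k sK; rewrite sE finset.setU11 K'K // => /(_ isT).
apply/andP; split; last by rewrite sE; apply: Ind_linkU1 => //; exact: K'K.
have ks : k \in s by rewrite sE finset.setU11.
apply/cone_generatorsP => -[/mG[sI _]|[j [jK jK' sE']]|[j [t' [jK' tG' sE']]]].
- by have := base_notin sI ks; rewrite K'K.
- by move: ks; rewrite sE' inE => /eqP kj; rewrite -kj kK' in jK'.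
have [tL' _] := mGk jK' tG'.
have kj : k = j.
  by move: ks; rewrite sE' => /finset.setU1P[//|/(link_notin tL')]; rewrite K'K.
rewrite -kj in tL' tG' sE'.
have nk r : r \in link k -> (k |: r) :\ k = r.
  by move=> rL; rewrite finset.setU1K //; apply/negP => /(link_notin rL); rewrite K'K.
by move: tG; rewrite -(nk t tL) -sE sE' (nk t' tL') tG'.
Qed.

End Independence.

Theorem theorem3p11 (R : realType) (T : finType) (e : rel T)
  (K : {set T}) (Gs : {set {set T}}) :
  simple_graph e ->
  (forall k1 k2, k1 \in K -> k2 \in K -> k1 != k2 -> e k1 k2) ->
  generating_faces R (Ind e (~: K)) Gs ->
  (forall k s, k \in K -> s \in Gs -> exists2 v, v \in s & e k v) ->
  (exists p0 : forall i, @summand R T e K i,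
      homotopy_equivalent R (realization R (Ind e [set: T]%SET)) (wedge p0)) /\
  (forall Gk : T -> {set {set T}},
      (forall k, k \in Kprime e K ->
         generating_faces R (Ind e (~: (K :|: nbhd e k))) (Gk k)) ->
      generating_faces R (Ind e [set: T]%SET)
        (Gs :|: [set [set k] | k in K :\: Kprime e K]
            :|: \bigcup_(k in Kprime e K) [set k |: s | s in Gk k])).
Proof.
move=> ge cK [mG cG] aG.
have dA := down_closed_setD (@Ind_down_closed T e (~: K)) mG.
have [q0 [h [ch [h0 h1]]]] := cG.
have Y_K := @base_notin T e K.
split.
  have AY s : s \in Ind e (~: K) :\: Gs -> s \in Ind e (~: K).
    by case/finset.setDP.
  have L0 k (_ : k \in K) : finset.set0 \in Ind e (~: (K :|: nbhd e k)).
    exact: Ind0.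
  (* For this [Y] and [L], [cone_summand] is convertible to [summand]; the base points are [q0] and
     the south poles. *)
  exists (cone_base (L := fun k => Ind e (~: (K :|: nbhd e k))) AY L0 q0).
  apply: (cone_wedge dA AY Y_K L0 _ _ ch h0 h1).
  - by move=> k s kK; exact: link_notin_generating.
  - by move=> s; exact: Ind_split.
move=> Gk gGk; split.
  apply: cone_generators_maximal => // k s kK sG.
  by have [/(_ s sG)] := gGk k kK.
have mGk k s : k \in Kprime e K -> s \in Gk k ->
    maximal_face (Ind e (~: (K :|: nbhd e k))) s.
  by move=> /gGk[+ _]; exact.
pose L k := Ind e (~: (K :|: nbhd e k)) :\: Gk k.
have K'K k : k \in Kprime e K -> k \in K by rewrite in_Kprime => /andP[].
have dL k : k \in Kprime e K -> down_closed (L k).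
  by move=> kK; apply: down_closed_setD (mGk k ^~ kK); exact: Ind_down_closed.
have L0 k : k \in Kprime e K -> finset.set0 \in L k.
  (* A contractible complex has a point, hence a face, and by down-closure the empty face. *)
  by move=> kK; have [_ [p _]] := gGk k kK; apply: down_closed_set0 p; exact: dL.
(* Here Y is A itself, so the summand [None] of the wedge is contractible by hypothesis. *)
have equiv := cone_wedge (K := Kprime e K) (Y := Ind e (~: K) :\: Gs) (L := L)
  dA (fun s => id) _ L0 _ (@generating_split T e K ge cK Gs mG Gk mGk) ch h0 h1.
apply: (contractible_homotopy_equivalent (equiv _ _)).
- move=> s v /finset.setDP[sK _] vs; apply: contra (Y_K s v sK vs); exact: K'K.
- move=> k s kK /finset.setDP[sL _]; apply: (link_notin_generating aG _ sL); exact: K'K.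
apply: wedge_contractible.
- exact: finite_finset.
- exact: cone_base_closed.
- exact: cG.
- move=> k; apply: (susp_contraction (dL _ (valP k)) (L0 _ (valP k))).
  by have [] := gGk _ (valP k).
Qed.
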